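(* Let $H(s)\in\mathcal{RH}_\infty$ be a square ($n\times n$) transfer function matrix. Suppose that for each $s=j\omega$ with $\omega\in[0,\infty)$, $$-1\notin \tau\operatorname{SRG}(H(j\omega))\qquad\text{for all }\tau\in(0,1],$$ where $-1$ denotes the point $(-1,0)$ of the complex plane. Then the closed-loop system obtained by placing $H$ in unity negative feedback is $\mathcal{L}_2$ stable.
   Context: $\mathcal{RH}_\infty$ is the space of rational, proper, stable transfer functions (matrices), representing bounded, causal linear time-invariant (LTI) operators on $\mathcal{L}_2$ signals. For $F\in\{\mathbb{R},\mathbb{C}\}$, $\mathcal{L}_2^n(F)$ is the space of square-integrable signals $u:\mathbb{R}_{\ge 0}\to F^n$ with inner product $\langle u,y\rangle=\int_0^\infty u(t)^*y(t)\,dt$ and norm $\|u\|=\sqrt{\langle u,u\rangle}$. Scaled relative graph (SRG) of a square matrix $A\in\mathbb{C}^{n\times n}$: $$\operatorname{SRG}(A)=\left\{\frac{\|y\|}{\|u\|}\exp\left(\pm j\arccos\left(\frac{\Re\langle y,u\rangle}{\|y\|\,\|u\|}\right)\right) : u\in\mathbb{C}^n,\ \|u\|=1,\ y=Au\right\}\subset\mathbb{C},$$ with the convention that the angle is $0$ if $\|y\|=0$ (so that such a $u$ contributes the point $0$). Here $j$ is the imaginary unit. For $\tau\in\mathbb{R}$ and $S\subset\mathbb{C}$, $\tau S=\{\tau z: z\in S\}$. Unity negative feedback: with external input $u$, error $e$ and output $y$, the loop is $e=u-y$, $y=He$; the closed-loop system is the system from $u$ to $y$. A system is $\mathcal{L}_2$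 stable if every (bounded) input $u\in\mathcal{L}_2$ produces a (bounded) output $y\in\mathcal{L}_2$.
   Formalization: The condition that -1 is not in τ SRG(H(jω)) for τ in (0,1] is also required at ω = ∞ (the limit matrix H(∞)); without it the claim fails, e.g. H(s) = -2s/(s+1), whose closed loop 2s/(s-1) is unstable. It is automatic for strictly proper H. *)

(* Defs.v *)
(* MathComp-Analysis; complex numbers are R[i] with R : realType.              *)
From mathcomp Require Import all_boot all_order all_algebra.
From mathcomp Require Import generic_quotient fraction complex.
From mathcomp Require Import all_classical all_reals all_analysis.
Set Implicit Arguments.
Unset Strict Implicit.
Unset Printing Implicit Defensive.
Import Order.TTheory GRing.Theory Num.Theory.
Local Open Scope classical_set_scope.
Local Open Scope ring_scope.

Section Complex.
Variable R : realType.

Definition cexp (z : R[i]) : R[i] :=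
  Complex (expR (complex.Re z) * cos (complex.Im z))
          (expR (complex.Re z) * sin (complex.Im z)).

(* <x, y> = x^* y, conjugate-linear in the first argument. *)
Definition cdot n (x y : 'cV[R[i]]_n) : R[i] :=
  \sum_(k < n) conjc (x k 0) * y k 0.

Definition vnorm n (x : 'cV[R[i]]_n) : R := Num.sqrt (complex.Re (cdot x x)).

Definition vangle n (y u : 'cV[R[i]]_n) : R :=
  if vnorm y == 0 then 0
  else acos (complex.Re (cdot y u) / (vnorm y * vnorm u)).

Definition SRG n (A : 'M[R[i]]_n) : set R[i] :=
  [set z | exists u : 'cV[R[i]]_n, vnorm u = 1 /\
     let y := A *m u in
     let gain := (vnorm y / vnorm u)%:C%C in
     z = gain * cexp (Complex 0 (vangle y u)) \/
     z = gain * cexp (Complex 0 (- vangle y u))].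

Definition dilate (tau : R) (S : set R[i]) : set R[i] :=
  [set tau%:C%C * z | z in S].

End Complex.

(* Scalar transfer functions are elements of R(s); numerator and denominator   *)
(* are those of a reduced fraction, so that the roots of the denominator are   *)
(* exactly the poles.                                                          *)
Section TransferFunctions.
Variable R : realType.
Implicit Type f : {fraction {poly R}}.

Definition tf_gcd f : {poly R} := gcdp (frac (repr f)).1 (frac (repr f)).2.
Definition tf_num f : {poly R} := (frac (repr f)).1 %/ tf_gcd f.
Definition tf_den f : {poly R} := (frac (repr f)).2 %/ tf_gcd f.

Definition tf_proper f : Prop := (size (tf_num f) <= size (tf_den f))%N.

Definition tf_stable f : Prop :=
  forall s : R[i], root (map_poly (real_complex R) (tf_den f)) s -> complex.Re s < 0.

Definition RHinf n (H : 'M[{fraction {poly R}}]_n) : Prop :=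
  forall k l, tf_proper (H k l) /\ tf_stable (H k l).

Definition tf_eval f (s : R[i]) : R[i] :=
  (map_poly (real_complex R) (tf_num f)).[s] / (map_poly (real_complex R) (tf_den f)).[s].

(* The limit of f(s) as |s| -> oo, for proper f. *)
Definition tf_infty f : R :=
  (tf_num f)`_(size (tf_den f)).-1 / lead_coef (tf_den f).

Definition tfm_eval n (H : 'M[{fraction {poly R}}]_n) (s : R[i]) : 'M[R[i]]_n :=
  map_mx (fun f => tf_eval f s) H.

(* H(j oo). A Nyquist condition at all finite frequencies says nothing about    *)
(* this point: -2s/(s+1) is never real and <= -1 on the imaginary axis, but its *)
(* closed loop 2s/(s-1) is unstable.                                            *)
Definition tfm_infty n (H : 'M[{fraction {poly R}}]_n) : 'M[R[i]]_n :=
  map_mx (fun f => (tf_infty f)%:C%C) H.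

End TransferFunctions.

(* Signals are functions on R of which only the restriction to [0, +oo[ is     *)
(* ever used. The set F of admissible sample values is the set of the real     *)
(* numbers or the whole of R[i].                                               *)
Section Signals.
Variables (R : realType) (n : nat).
Let mu := @lebesgue_measure R.
Let time : set R := `[0, +oo[.
Let signal := R -> 'cV[R[i]]_n.

Definition real_scalars : set R[i] := [set z | complex.Im z = 0].
Definition complex_scalars : set R[i] := setT.

Definition is_signal (F : set R[i]) (y : signal) : Prop :=
  forall k, (forall t, 0 <= t -> F (y t k 0)) /\
    measurable_fun time (fun t => complex.Re (y t k 0)) /\
    measurable_fun time (fun t => complex.Im (y t k 0)).

Definition L2 (F : set R[i]) (y : signal) : Prop :=
  is_signal F y /\
  (\int[mu]_(t in time) ((vnorm (y t)) ^+ 2)%:E < +oo)%E.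

Definition laplace_abs (sigma : R) (y : signal) : Prop :=
  mu.-integrable time (fun t => (expR (- sigma * t) * vnorm (y t))%:E).

Definition laplace (y : signal) (s : R[i]) : 'cV[R[i]]_n :=
  \col_k Complex
    (\int[mu]_(t in time) complex.Re (cexp (- s * t%:C%C) * y t k 0))
    (\int[mu]_(t in time) complex.Im (cexp (- s * t%:C%C) * y t k 0)).

(* y = H e for the causal operator with transfer matrix H. For e and y in L2   *)
(* the condition says that the Laplace transforms satisfy Y = H E; it is given *)
(* on an arbitrary right half-plane so that it also makes sense for outputs    *)
(* that are not in L2 and grow exponentially.                                  *)
Definition lti (H : 'M[{fraction {poly R}}]_n) (e y : signal) : Prop :=
  exists sigma : R, [/\ 0 <= sigma, laplace_abs sigma e, laplace_abs sigma y &
    forall s : R[i], sigma < complex.Re s ->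
      laplace y s = tfm_eval H s *m laplace e s].

Definition closed_loop (H : 'M[{fraction {poly R}}]_n) (u y : signal) : Prop :=
  exists e : signal, (forall t, 0 <= t -> e t = u t - y t) /\ lti H e y.

Definition L2_stable (F : set R[i]) (sys : signal -> signal -> Prop) : Prop :=
  forall u, L2 F u ->
    (exists y, is_signal F y /\ sys u y) /\
    (forall y, is_signal F y -> sys u y -> L2 F y).

End Signals.

(* Main.v *)
(* If [-1] is not in [tau SRG(H(jw))], then [det (I + tau H(jw)) <> 0]: a unit kernel vector  *)
(* [u] gives [H u = - u / tau], whose SRG point is [exp(j pi) / tau].  With a common Hurwitz     *)
(* denominator [H = N / D], the polynomial [det (D I + tau N)] has constant degree (condition  *)
(* at infinity) and no root on the imaginary axis for [0 <= tau <= 1], so its roots cannot     *)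
(* leave the open left half-plane where they are at [tau = 0]; hence [(I + H)^-1 H] is proper  *)
(* and stable.  Partial fractions reduce a proper stable filter to first-order lags            *)
(* [1 / (s - p)], i.e. convolutions with [exp(p t)], which preserve L2 by Cauchy-Schwarz and    *)
(* Tonelli and have the right Laplace transform by Fubini.  Any other output has the same      *)
(* Laplace transform on a half-line, hence agrees almost everywhere by Lerch's theorem.         *)
Require Import Defs.
From mathcomp Require Import all_boot all_order all_algebra.
From mathcomp Require Import perm fraction complex.
From mathcomp Require Import all_classical all_reals all_analysis.
From mathcomp Require Import measurable_realfun.
From mathcomp Require Import ring lra.
Import Order.TTheory GRing.Theory Num.Theory.
Import numFieldNormedType.Exports.
Local Open Scope classical_set_scope.
Local Open Scope ring_scope.
Set Implicit Arguments.
Unset Strict Implicit.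
Unset Printing Implicit Defensive.

Local Notation rc := (real_complex _).
Local Notation cpoly := (map_poly (real_complex _)).
Local Notation mu := (@lebesgue_measure _).
Local Notation time := ([set` `[0, +oo[%R] : set (measurableTypeR _)).

(** * Hurwitz polynomials under homotopy *)

(** The hypothesis is a homotopy form of the Nyquist criterion: if [1 + tau H(jw)] were singular, -1
    would lie in [tau SRG(H(jw))] ([SRG_det]). Write [H = N / D] over a common Hurwitz denominator.
    For tau in [0, 1] the polynomials [det (D + tau N)] have no root on the imaginary axis, and the
    condition at infinity keeps their top coefficient nonzero ([coef_det_pencil]). Along such a
    family both being Hurwitz and failing to be Hurwitz are open conditions ([hurwitz_open],
    [not_hurwitz_open]), so [hurwitz_homotopy] carries the property from [D ^ n] at tau = 0 to
    [P = det (D + N)] at tau = 1.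

    Stability then has two halves. An L2 output exists because the closed loop has transfer matrix
    [adj (D + N) N / P], whose entries are proper since [P] has full degree; [rational_filter]
    builds each entry from first-order lags ([slaplace_lag]), and convolution with a decaying
    exponential preserves L2 ([rL2_conv]). Every other output, even one only assumed to have a
    Laplace transform far to the right, has the same transform there, because [P] does not vanish;
    [lerch] makes the two outputs equal almost everywhere, and [rL2_ae] transfers square
    integrability. *)

Definition hurwitz (R : realType) (p : {poly R}) : Prop :=
  forall s : R[i], root (cpoly p) s -> complex.Re s < 0.

Lemma hurwitz_neq0 (R : realType) (p : {poly R}) : hurwitz p -> p != 0.
Proof.
move=> hp; apply/eqP => E; have := hp 1; rewrite E rmorph0 root0 => /(_ isT) /=.
by rewrite ltr10.
Qed.

(** The l1 distance between coefficient vectors, which metrises polynomials of degree at most [m].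
    It turns coefficientwise continuity of a path into closeness of polynomials. *)
Definition coef_dist (R : realType) m (p q : {poly R}) : R :=
  \sum_(i < m.+1) `|p`_i - q`_i|.

Lemma normr_real_complex (R : realType) (x : R) : `|rc x| = rc `|x|.
Proof. by rewrite normc_def /= expr0n addr0 sqrtr_sqr. Qed.

(** Each [|z| ^ i] with [i <= m] is at most [(1 + |z|) ^ m]. This weight makes the estimate usable
    on an unbounded half-plane. *)
Lemma cpoly_horner_dist (R : realType) m (p q : {poly R}) (z : R[i]) :
  (size p <= m.+1)%N -> (size q <= m.+1)%N ->
  `|(cpoly p).[z] - (cpoly q).[z]| <= rc (coef_dist m p q) * (1 + `|z|) ^+ m.
Proof.
move=> sp sq.
have E (r : {poly R}) : (size r <= m.+1)%N -> (cpoly r).[z] = \sum_(i < m.+1) rc r`_i * z ^+ i.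
  move=> sr; rewrite (@horner_coef_wide _ m.+1) ?(leq_trans (size_poly _ _))//.
  by apply: eq_bigr => i _; rewrite coef_map.
rewrite !E// -sumrB rmorph_sum mulr_suml.
apply: le_trans (ler_norm_sum _ _ _) _; apply: ler_sum => i _.
rewrite -mulrBl -rmorphB normrM normr_real_complex; apply: ler_wpM2l.
  by rewrite ler0c.
rewrite normrX; apply: le_trans (_ : (1 + `|z|) ^+ i <= _).
  by apply: lerXn2r; rewrite ?nnegrE ?addr_ge0 ?ler01 // lerDr ler01.
by apply: ler_weXn2l; rewrite ?lerDl// -ltnS.
Qed.

(** Stated with a formal degree [m] rather than the size of [p], so that a polynomial and its
    perturbation are factored against the same exponent. *)
Lemma cpoly_factor (R : realType) m (p : {poly R}) :
  (size p <= m.+1)%N -> p`_m != 0 ->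
  exists2 rs : seq R[i], size rs = m &
    forall z, (cpoly p).[z] = rc p`_m * \prod_(x <- rs) (z - x) /\
      (z \in rs -> root (cpoly p) z).
Proof.
move=> sp pm.
have szp : size p = m.+1.
  apply/eqP; rewrite eqn_leq sp /= ltnNge; apply: contra pm => h.
  by rewrite nth_default.
have [rs E] := closed_field_poly_normal (cpoly p).
have sE : size (cpoly p) = m.+1 by rewrite size_map_poly.
have lE : lead_coef (cpoly p) = rc p`_m by rewrite lead_coef_map lead_coefE szp.
have c0 : rc p`_m != 0 by rewrite fmorph_eq0.
exists rs.
  by move: sE; rewrite E lE size_scale// size_prod_XsubC => -[].
move=> z; split.
  rewrite E lE hornerZ horner_prod; congr (_ * _).
  by apply: eq_bigr => x _; rewrite !hornerE.
by move=> zr; rewrite E lE rootZ// root_prod_XsubC.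
Qed.

Lemma ler_exp_prod (F : numDomainType) (T : eqType) (a : F) (rs : seq T) (f : T -> F) :
  0 <= a -> (forall x, x \in rs -> a <= f x) -> a ^+ size rs <= \prod_(x <- rs) f x.
Proof.
move=> a0; elim: rs => [|x rs IH] h; first by rewrite big_nil expr0.
rewrite big_cons exprS ler_pM ?exprn_ge0 ?h ?mem_head//.
by apply: IH => y yr; rewrite h// inE yr orbT.
Qed.

(* On the closed right half-plane [|z - x| >= k (1 + |z|)] for every root [x] of [p], so
   [|p(z)|] dominates the perturbation of its value uniformly in [z]. *)
Lemma hurwitz_open (R : realType) m (p : {poly R}) :
  (size p <= m.+1)%N -> p`_m != 0 -> hurwitz p ->
  exists2 d : R, 0 < d & forall q : {poly R}, (size q <= m.+1)%N ->
    coef_dist m p q < d -> hurwitz q.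
Proof.
move=> sp pm hp; have [rs sz Hrs] := cpoly_factor sp pm.
have hrs x : x \in rs -> complex.Re x < 0 by move=> xr; apply: hp; apply: (Hrs x).2.
have [k k0 Hk] : exists2 k : R, 0 < k & forall z x, 0 <= complex.Re z -> x \in rs ->
    rc k * (1 + `|z|) <= `|z - x|.
  elim: rs hrs {sz Hrs} => [|x rs IH] hrs; first by exists 1.
  have [k k0 Hk] := IH (fun y yr => hrs y (mem_behead (s := x :: rs) yr)).
  have rx : complex.Re x < 0 by apply: hrs; rewrite inE eqxx.
  set e := - complex.Re x; have e0 : 0 < e by rewrite oppr_gt0.
  set B := Num.sqrt (complex.Re x ^+ 2 + complex.Im x ^+ 2).
  have nB : `|x| = rc B by rewrite normc_def.
  have B0 : 0 <= B by rewrite sqrtr_ge0.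
  (* This constant combines [|z - x| >= e] and [|z - x| >= |z| - B]: adding [1 + B] times the first
     to [e] times the second gives [(e + 1 + B) |z - x| >= e (1 + |z|)]. *)
  pose k' := e / (e + 1 + B).
  have d0 : 0 < e + 1 + B by rewrite -addrA ltr_wpDr ?addr_ge0 ?ler01.
  exists (Num.min k k'); first by rewrite lt_min k0 divr_gt0.
  move=> z y rz; rewrite inE => /orP[/eqP->|yr]; last first.
    apply: le_trans (Hk z y rz yr); apply: ler_wpM2r; first by rewrite addr_ge0.
    by rewrite lecR ge_min lexx.
  apply: le_trans (_ : rc k' * (1 + `|z|) <= _).
    apply: ler_wpM2r; first by rewrite addr_ge0.
    by rewrite lecR ge_min lexx orbT.
  have h1 : rc e <= `|z - x|.
    apply: le_trans (normc_ge_Re _); rewrite lecR.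
    apply: le_trans (ler_norm _); rewrite /e.
    by case: (z) (x) rz => [a b] [c d] /=; lra.
  have h2 : `|z| <= `|z - x| + rc B.
    by rewrite -nB -{1}(subrK x z) ler_normD.
  move: h1 h2; rewrite (normc_def (z - x)) (normc_def z) -rmorphD -[1]/(rc 1) -rmorphD.
  rewrite -rmorphM !lecR /k' => h1 h2.
  rewrite mulrAC ler_pdivrMr//; nra.
exists (`|p`_m| * k ^+ m); first by rewrite mulr_gt0 ?normr_gt0 ?exprn_gt0.
move=> q sq; rewrite ltNge => /negP dq z rz; rewrite ltNge; apply/negP => z0.
apply: dq.
have := cpoly_horner_dist z sp sq; move/rootP: rz => ->; rewrite subr0.
rewrite (Hrs z).1 normrM normr_real_complex => H.
have Z0 : 0 < (1 + `|z|) ^+ m by rewrite exprn_gt0// ltr_wpDr.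
rewrite -lecR -(ler_pM2r Z0); apply: le_trans H.
rewrite rmorphM -mulrA ler_wpM2l ?ler0c//.
rewrite rmorphXn -exprMn normr_prod -sz; apply: ler_exp_prod => [|x xr].
  by rewrite mulr_ge0 ?ler0c ?addr_ge0// ltW.
exact: Hk.
Qed.

(** Continuity of roots is avoided. If [q] were Hurwitz, all its roots would be at distance at least
    [r = Re z] from [z], so |q(z)| would be at least |q_m| r^m. But p(z) = 0 bounds |q(z)| by the
    coefficient distance times B^m, with B = 1 + |z|. Since |q_m| is at least |p_m| minus that
    distance, the distance is at least |p_m| r^m / (r^m + B^m), which is the radius chosen. *)
Lemma not_hurwitz_open (R : realType) m (p : {poly R}) (z : R[i]) :
  (size p <= m.+1)%N -> p`_m != 0 -> root (cpoly p) z -> 0 < complex.Re z ->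
  exists2 d : R, 0 < d & forall q : {poly R}, (size q <= m.+1)%N ->
    coef_dist m p q < d -> ~ hurwitz q.
Proof.
move=> sp pm rz z0.
set r := complex.Re z in z0.
set B := 1 + Num.sqrt (complex.Re z ^+ 2 + complex.Im z ^+ 2).
have nB : 1 + `|z| = rc B by rewrite normc_def rmorphD rmorph1.
have B0 : 0 < B by rewrite ltr_wpDr// sqrtr_ge0.
have d0 : 0 < r ^+ m + B ^+ m by rewrite addr_gt0 ?exprn_gt0.
exists (`|p`_m| * r ^+ m / (r ^+ m + B ^+ m)).
  by rewrite divr_gt0// mulr_gt0 ?normr_gt0 ?exprn_gt0.
move=> q sq; rewrite ltr_pdivlMr// => dq hq.
have dm : `|p`_m - q`_m| <= coef_dist m p q.
  rewrite /coef_dist (bigD1 ord_max)//= lerDl; exact: sumr_ge0.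
have tri : `|p`_m| <= coef_dist m p q + `|q`_m|.
  by apply: le_trans (lerD dm (lexx _)); rewrite -{1}(subrK q`_m p`_m) ler_normD.
have qz : `|q`_m| * r ^+ m <= coef_dist m p q * B ^+ m.
  have [->|qm] := eqVneq (q`_m) 0.
    by rewrite normr0 mul0r mulr_ge0 ?exprn_ge0 ?(ltW B0)// sumr_ge0.
  have [rs sz Hrs] := cpoly_factor sq qm.
  rewrite -lecR !rmorphM.
  have := cpoly_horner_dist z sp sq; move/rootP: rz => ->; rewrite sub0r normrN.
  rewrite nB -rmorphXn; apply: le_trans.
  rewrite (Hrs z).1 normrM normr_real_complex; apply: ler_wpM2l; first by rewrite ler0c.
  rewrite rmorphXn normr_prod -sz; apply: ler_exp_prod => [|x xr].
    by rewrite ler0c ltW.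
  apply: le_trans (normc_ge_Re _); rewrite lecR.
  apply: le_trans (ler_norm _).
  have : complex.Re x < 0 by apply: hq; apply: (Hrs x).2.
  by rewrite /r; case: (z) (x) => [a b] [c d] /=; lra.
have rm : 0 < r ^+ m by rewrite exprn_gt0.
have : `|p`_m| * r ^+ m <= (coef_dist m p q + `|q`_m|) * r ^+ m by rewrite ler_pM2r.
move: dq qz; rewrite mulrDr mulrDl; lra.
Qed.

(* Being Hurwitz is locally constant along the path; the intermediate value theorem applied to
   its indicator plays the role of connectedness. *)
Lemma hurwitz_homotopy (R : realType) m (P : R -> {poly R}) :
  (forall i, continuous (fun t => (P t)`_i)) ->
  (forall t, 0 <= t <= 1 -> (size (P t) <= m.+1)%N) ->
  (forall t, 0 <= t <= 1 -> (P t)`_m != 0) ->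
  (forall t w, 0 <= t <= 1 -> ~~ root (cpoly (P t)) (Complex 0 w)) ->
  hurwitz (P 0) -> hurwitz (P 1).
Proof.
move=> cP sP lP iP h0; apply: contrapT => h1.
pose f (t : R) : R := if `[< hurwitz (P t) >] then 0 else 1.
have near_dist t0 (d : R) : 0 < d -> \forall t \near t0, coef_dist m (P t0) (P t) < d.
  move=> d0.
  have : coef_dist m (P t0) (P t) @[t --> t0] --> coef_dist m (P t0) (P t0).
    rewrite /coef_dist; elim: (index_enum _) => [|i r IH].
      by under eq_fun do rewrite big_nil; rewrite big_nil; exact: cvg_cst.
    under eq_fun do rewrite big_cons; rewrite big_cons; apply: cvgD IH.
    by apply: cvg_norm; apply: cvgB; [exact: cvg_cst|exact: cP].
  have -> : coef_dist m (P t0) (P t0) = 0.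
    by rewrite /coef_dist big1// => i _; rewrite subrr normr0.
  move=> /cvgrPdist_lt /(_ _ d0); apply: filterS => t.
  by rewrite sub0r normrN; apply: le_lt_trans; exact: ler_norm.
have cf : {within `[0, 1], continuous f}.
  apply/subspace_continuousP => t0 /= t01.
  have t01' : 0 <= t0 <= 1 by move: t01; rewrite in_itv.
  suff : \forall t \near within `[0, 1] (nbhs t0), f t0 = f t.
    by move=> h; apply: cvg_near_cst; apply: filterS h => t ht; exact: esym.
  rewrite near_withinE.
  have [ht|ht] := pselect (hurwitz (P t0)).
    have [d d0 Hd] := hurwitz_open (sP _ t01') (lP _ t01') ht.
    have := near_dist t0 d d0; apply: filterS => t dt /=; rewrite in_itv /= => t1.
    by rewrite /f !asboolT//; apply: (Hd _ (sP _ t1)).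
  (* A non-Hurwitz member has a root with nonnegative real part; as the axis carries no root, it
     lies in the open right half-plane, where [not_hurwitz_open] applies. *)
  have [z /[dup] rz + z0] : exists2 z, root (cpoly (P t0)) z & 0 <= complex.Re z.
    apply: contrapT => h; apply: ht => z rz; rewrite ltNge; apply/negP => z0.
    by apply: h; exists z.
  move=> rz'; have {}z0 : 0 < complex.Re z.
    rewrite lt_neqAle z0 andbT; apply/eqP => zE; move: rz'.
    have -> : z = Complex 0 (complex.Im z) by rewrite zE; case: (z).
    by apply/negP/iP.
  have [d d0 Hd] := not_hurwitz_open (sP _ t01') (lP _ t01') rz z0.
  have := near_dist t0 d d0; apply: filterS => t dt /=; rewrite in_itv /= => t1.
  by rewrite /f !asboolF//; apply: (Hd _ (sP _ t1)).
have f0 : f 0 = 0 by rewrite /f asboolT.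
have f1 : f 1 = 1 by rewrite /f asboolF.
have [|c _] := @IVT R f 0 1 (1/2) ler01 cf.
  rewrite f0 f1 ge_min le_max; lra.
by rewrite /f; case: ifP => _; lra.
Qed.

(** * Scaled relative graphs and the return difference *)

Lemma Re_rcM (R : realType) (a : R) (z : R[i]) : complex.Re (rc a * z) = a * complex.Re z.
Proof. by case: z => x y /=; rewrite mul0r subr0. Qed.

Lemma Im_rcM (R : realType) (a : R) (z : R[i]) : complex.Im (rc a * z) = a * complex.Im z.
Proof. by case: z => x y /=; rewrite mul0r addr0. Qed.

Lemma cdotZl (R : realType) n (a : R) (x y : 'cV[R[i]]_n) :
  cdot (rc a *: x) y = rc a * cdot x y.
Proof.
rewrite /cdot mulr_sumr; apply: eq_bigr => k _.
by rewrite !mxE [conjc (_ * _)]rmorphM /= oppr0 mulrA.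
Qed.

Lemma Re_cdotE (R : realType) n (x : 'cV[R[i]]_n) :
  complex.Re (cdot x x) = \sum_(k < n) (complex.Re (x k 0) ^+ 2 + complex.Im (x k 0) ^+ 2).
Proof.
have -> : cdot x x = rc (\sum_(k < n) (complex.Re (x k 0) ^+ 2 + complex.Im (x k 0) ^+ 2)).
  rewrite rmorph_sum /cdot; apply: eq_bigr => k _.
  by rewrite mulrC -sqr_normc -add_Re2_Im2.
by [].
Qed.

Lemma vnorm_sqr (R : realType) n (x : 'cV[R[i]]_n) :
  vnorm x ^+ 2 = \sum_(k < n) (complex.Re (x k 0) ^+ 2 + complex.Im (x k 0) ^+ 2).
Proof.
by rewrite /vnorm sqr_sqrtr Re_cdotE// sumr_ge0// => k _; rewrite addr_ge0 ?sqr_ge0.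
Qed.

Lemma vnormZ (R : realType) n (a : R) (x : 'cV[R[i]]_n) :
  vnorm (rc a *: x) = `|a| * vnorm x.
Proof.
rewrite /vnorm !Re_cdotE -sqrtr_sqr -sqrtrM ?sqr_ge0//; congr Num.sqrt.
rewrite mulr_sumr; apply: eq_bigr => k _.
by rewrite mxE Re_rcM Im_rcM !exprMn mulrDr.
Qed.

Lemma vnorm_eq0 (R : realType) n (x : 'cV[R[i]]_n) : vnorm x = 0 -> x = 0.
Proof.
move=> /(congr1 (fun t => t ^+ 2)); rewrite vnorm_sqr expr0n /= => /eqP.
rewrite psumr_eq0; last by move=> k _; rewrite addr_ge0 ?sqr_ge0.
move=> /allP h; apply/matrixP => k j; rewrite ord1 mxE.
have := h k (mem_index_enum _); rewrite implyTb paddr_eq0 ?sqr_ge0// !sqrf_eq0.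
by case: (x k 0) => a b /= /andP[/eqP-> /eqP->].
Qed.

(** A unit vector [u] in the kernel satisfies [A u = - u / tau]: its gain is [1 / tau] and its angle
    is [acos (-1) = pi], so it contributes the point [- 1 / tau]. *)
Lemma SRG_det (R : realType) n (A : 'M[R[i]]_n) (tau : R) : 0 < tau ->
  ~ dilate tau (SRG A) (-1) -> \det (1%:M + rc tau *: A) != 0.
Proof.
move=> t0 h; apply/negP => /eqP d0; apply: h.
(* [det0P] produces a row vector in the left kernel; transposing first turns it into a column vector
   in the right kernel. *)
have : \det (1%:M + rc tau *: A)^T == 0 by rewrite det_tr d0.
move=> /det0P[v v0 /(congr1 trmx)].
rewrite trmx_mul trmxK trmx0; set x := v^T => Ax.
have x0 : vnorm x != 0.
  by apply: contra_neq v0 => /vnorm_eq0 E; rewrite -(trmxK v) -/x E trmx0.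
have xp : 0 < vnorm x by rewrite lt_neqAle eq_sym x0 sqrtr_ge0.
pose u := rc (vnorm x)^-1 *: x.
have nu : vnorm u = 1 by rewrite vnormZ gtr0_norm ?invr_gt0// mulVf.
have Au : A *m u = rc (- tau^-1) *: u.
  move: Ax; rewrite mulmxDl mul1mx -scalemxAl => /eqP; rewrite addrC addr_eq0 => /eqP E.
  rewrite /u -scalemxAr scalerA mulrC -scalerA; congr (_ *: _).
  rewrite rmorphN scaleNr -scalerN -E scalerA -rmorphM mulVf ?gt_eqF//.
  by rewrite rmorph1 scale1r.
have ny : vnorm (A *m u) = tau^-1.
  by rewrite Au vnormZ nu mulr1 normrN gtr0_norm// invr_gt0.
have an : vangle (A *m u) u = pi.
  rewrite /vangle ny invr_eq0 gt_eqF// nu mulr1 Au cdotZl Re_rcM Re_cdotE -vnorm_sqr.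
  by rewrite nu expr1n mulr1 mulNr mulfV ?acosN1// invr_eq0 gt_eqF.
exists (rc tau^-1 * cexp (Complex 0 pi)).
  exists u; split=> //=; left.
  by rewrite an ny nu divr1.
rewrite mulrA -rmorphM mulfV ?gt_eqF// rmorph1 mul1r /cexp /= expR0 !mul1r cospi sinpi.
by apply/eqP; rewrite eq_complex /= oppr0 !eqxx.
Qed.

(** * Degrees of determinants of polynomial matrices *)

Lemma coefM_size (R : nzRingType) (p q : {poly R}) a b :
  (size p <= a.+1)%N -> (size q <= b.+1)%N -> (p * q)`_(a + b) = p`_a * q`_b.
Proof.
move=> sp sq; rewrite coefM.
have la : (a < (a + b).+1)%N by rewrite ltnS leq_addr.
rewrite (bigD1 (Ordinal la))//= addKn big1 ?addr0// => j.
rewrite -val_eqE /= => ja.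
have [ltja|ltaj|E] := ltngtP (j : nat) a; last by rewrite E eqxx in ja.
  rewrite [q`__]nth_default ?mulr0//; apply: leq_trans sq _.
  by rewrite ltn_subRL ltn_add2r.
by rewrite nth_default ?mul0r//; apply: leq_trans sp _.
Qed.

Lemma size_prod_seq (R : comNzRingType) (I : Type) (r : seq I) (F : I -> {poly R}) d :
  (forall i, size (F i) <= d.+1)%N ->
  (size (\prod_(i <- r) F i)%R <= (size r * d).+1)%N /\
  (\prod_(i <- r) F i)`_(size r * d) = \prod_(i <- r) (F i)`_d.
Proof.
move=> sF; elim: r => [|i r [IHs IHc]]; first by rewrite !big_nil size_poly1 coef1.
rewrite !big_cons mulSn; split; last by rewrite coefM_size// IHc.
apply: leq_trans (size_polyMleq _ _) _.
by rewrite -subn1 leq_subLR add1n -addnS -addSn leq_add.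
Qed.

(** Every term of the Leibniz expansion is a product of [n] entries of formal degree [d], and taking
    the coefficient at the formal degree is multiplicative, so it commutes with the determinant. *)
Lemma det_size (R : comNzRingType) n d (A : 'M[{poly R}]_n) :
  (forall i j, size (A i j) <= d.+1)%N ->
  (size (\det A) <= (n * d).+1)%N /\
  (\det A)`_(n * d) = \det (map_mx (fun p : {poly R} => p`_d) A).
Proof.
move=> sA.
have sz : size (index_enum 'I_n) = n by rewrite -[RHS]card_ord cardT enumT.
have H (s : 'S_n) := size_prod_seq (index_enum _) (fun i => sA i (s i)).
rewrite sz in H; split.
  apply: leq_trans (size_sum _ _ _) _; apply/bigmax_leqP => s _.
  by rewrite mulr_sign; case: ifP => _; rewrite ?size_polyN; case: (H s).
rewrite coef_sum; apply: eq_bigr => s _.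
have E : \prod_i (map_mx (fun p : {poly R} => p`_d) A) i (s i) = (\prod_i A i (s i))`_(n * d).
  by rewrite (H s).2; apply: eq_bigr => i _; rewrite mxE.
by rewrite E !mulr_sign; case: ifP => _; rewrite ?coefN.
Qed.

Lemma cofactor_size (R : comNzRingType) n d (A : 'M[{poly R}]_n) i j :
  (forall i j, size (A i j) <= d.+1)%N -> (size (cofactor A i j) <= (n.-1 * d).+1)%N.
Proof.
move=> sA; rewrite /cofactor -signr_odd mulr_sign.
have : (size (\det (row' i (col' j A))) <= (n.-1 * d).+1)%N.
  by apply: (proj1 (det_size _)) => k l; rewrite !mxE.
by case: ifP => _; rewrite ?size_polyN.
Qed.

Definition cmx_eval (R : realType) n (N : 'M[{poly R}]_n) (s : R[i]) : 'M[R[i]]_n :=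
  map_mx (fun p => (cpoly p).[s]) N.

Lemma det_cmx_eval (R : realType) n (N : 'M[{poly R}]_n) (s : R[i]) :
  (cpoly (\det N)).[s] = \det (cmx_eval N s).
Proof. by rewrite -[LHS]/((horner_eval s \o cpoly) (\det N)) -det_map_mx. Qed.

Lemma root_cpoly_conj (R : realType) (p : {poly R}) s :
  root (cpoly p) (conjc s) = root (cpoly p) s.
Proof.
rewrite -complex_root_conj -map_poly_comp; congr (root _ s).
by apply: eq_map_poly => x /=; rewrite oppr0.
Qed.

Lemma pencil_size (R : realType) n (D : {poly R}) (N : 'M[{poly R}]_n) (t : R) k l :
  (forall k l, size (N k l) <= size D)%N ->
  (size ((D%:M + t%:P *: N)%R k l) <= size D)%N.
Proof.
move=> sN; rewrite !mxE; apply: leq_trans (size_polyD _ _) _; rewrite geq_max; apply/andP; split.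
  by case: eqP => _; rewrite ?mulr1n ?mulr0n ?size_poly0.
by rewrite mul_polyC; apply: leq_trans (size_scale_leq _ _) _.
Qed.

(** When [N / D] is a transfer matrix, the matrix of ratios on the right is its value at infinity.
    Thus nonsingularity of [1 + t H(oo)] says exactly that the degree of the determinant does not
    drop. *)
Lemma coef_det_pencil (R : realType) n (D : {poly R}) (N : 'M[{poly R}]_n) (t : R) :
  let d := (size D).-1 in
  D != 0 -> (forall k l, size (N k l) <= size D)%N ->
  (\det (D%:M + t%:P *: N))`_(n * d) = lead_coef D ^+ n *
    \det (1%:M + t *: map_mx (fun p : {poly R} => p`_d / lead_coef D) N).
Proof.
move=> d D0 sN.
have sE k l : (size ((D%:M + t%:P *: N)%R k l) <= d.+1)%N.
  by rewrite prednK ?size_poly_gt0//; exact: pencil_size.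
rewrite (det_size sE).2 -detZ; congr (\det _).
apply/matrixP => k l; rewrite !mxE coefD coefCM mulrDr; congr (_ + _).
  by rewrite lead_coefE; case: eqP => _; rewrite ?mulr1n ?mulr1 ?mulr0n ?mulr0 ?coef0.
by rewrite mulrCA [lead_coef D * _]mulrC divfK// lead_coef_eq0.
Qed.

Lemma hurwitz_det (R : realType) n (D : {poly R}) (N : 'M[{poly R}]_n) :
  let d := (size D).-1 in
  hurwitz D -> (forall k l, size (N k l) <= size D)%N ->
  (forall w t : R, 0 <= w -> 0 < t <= 1 ->
     \det (1%:M + rc t *: ((cpoly D).[Complex 0 w]^-1 *: cmx_eval N (Complex 0 w))) != 0) ->
  (forall t : R, 0 < t <= 1 ->
     \det (1%:M + t *: map_mx (fun p : {poly R} => p`_d / lead_coef D) N) != 0) ->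
  hurwitz (\det (D%:M + N)).
Proof.
move=> d hD sN hw hoo.
have D0 := hurwitz_neq0 hD.
have sD : size D = d.+1 by rewrite prednK// size_poly_gt0.
pose P (t : R) : {poly R} := \det (D%:M + t%:P *: N).
have sE t k l : (size ((D%:M + t%:P *: N)%R k l) <= d.+1)%N.
  by rewrite -sD; exact: pencil_size.
have -> : \det (D%:M + N) = P 1 by rewrite /P scale1r.
apply: (@hurwitz_homotopy R (n * d)).
(* [B] is the determinant as a polynomial in the homotopy parameter with coefficients in [{poly R}];
   hence each coefficient of [P t] is itself polynomial in [t], and continuous. *)
- move=> i; pose B : {poly {poly R}} :=
    \det (map_mx polyC D%:M + 'X *: map_mx polyC N).
  have E t : P t = B.[t%:P].
    rewrite /P /B -[RHS]/(horner_eval t%:P _) -det_map_mx; congr (\det _).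
    by apply/matrixP => k l; rewrite !mxE /= /horner_eval !hornerE.
  have -> : (fun t => (P t)`_i) = horner (\poly_(j < size B) (B`_j)`_i).
    apply/funext => t; rewrite E horner_coef horner_poly coef_sum.
    by apply: eq_bigr => j _; rewrite -rmorphXn /= coefMC.
  exact: continuous_horner.
- by move=> t _; case: (det_size (sE t)).
- move=> t /andP[t0 t1]; rewrite /P coef_det_pencil// mulf_neq0 ?expf_neq0 ?lead_coef_eq0//.
  move: t0; rewrite le_eqVlt => /orP[/eqP<-|t0]; last by rewrite hoo ?t0.
  by rewrite scale0r addr0 det1 oner_neq0.
- move=> t w /andP[t0 t1].
  (* The hypothesis covers only nonnegative frequencies; real coefficients make the root set
     symmetric under conjugation. *)
  wlog w0 : w / 0 <= w.
    move=> h; have [|w0] := leP 0 w; first exact: h.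
    by rewrite -root_cpoly_conj /=; apply: h; rewrite oppr_ge0 ltW.
  set s := Complex 0 w.
  have Ds : (cpoly D).[s] != 0.
    by apply/negP => /hD /=; rewrite ltxx.
  rewrite /root det_cmx_eval.
  have -> : cmx_eval (D%:M + t%:P *: N) s =
     (cpoly D).[s] *: (1%:M + rc t *: ((cpoly D).[s]^-1 *: cmx_eval N s)).
    apply/matrixP => k l; rewrite !mxE rmorphD rmorphM /= hornerD hornerM mulrDr.
    rewrite map_polyC hornerC; congr (_ + _).
      by case: eqP => _; rewrite ?mulr1n ?mulr1 ?mulr0n ?rmorph0 ?horner0 ?mulr0.
    by rewrite mulrCA mulVKf.
  rewrite detZ mulf_neq0 ?expf_neq0//.
  move: t0; rewrite le_eqVlt => /orP[/eqP<-|t0]; last by rewrite hw ?t0.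
  by rewrite rmorph0 scale0r addr0 det1 oner_neq0.
- rewrite /P scale0r addr0 det_scalar => s; rewrite rmorphXn /root horner_exp expf_eq0.
  by move=> /andP[_ /hD].
Qed.

(** * A common Hurwitz denominator for the transfer matrix *)

Lemma hurwitz_horner (R : realType) (p : {poly R}) s :
  hurwitz p -> 0 <= complex.Re s -> (cpoly p).[s] != 0.
Proof. by move=> hp s0; apply/negP => /hp; rewrite ltNge s0. Qed.

Lemma hurwitz_prod (R : realType) (I : Type) (r : seq I) (P : pred I) (F : I -> {poly R}) :
  (forall i, P i -> hurwitz (F i)) -> hurwitz (\prod_(i <- r | P i) F i).
Proof.
move=> hF; elim/big_rec: _ => [|i p Pi hp] s; first by rewrite rmorph1 (negPf (root1 _)).
by rewrite rmorphM rootM => /orP[/hF -> //|/hp].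
Qed.

(** The product of all entry denominators is used instead of their least common multiple: the
    Hurwitz property and degrees pass to products directly. *)
Definition tfm_den (R : realType) n (H : 'M[{fraction {poly R}}]_n) : {poly R} :=
  \prod_(p : 'I_n * 'I_n) tf_den (H p.1 p.2).

Definition tfm_num (R : realType) n (H : 'M[{fraction {poly R}}]_n) : 'M[{poly R}]_n :=
  \matrix_(k, l) (tf_num (H k l) * \prod_(p | p != (k, l)) tf_den (H p.1 p.2)).

Section CommonDenominator.
Variables (R : realType) (n : nat) (H : 'M[{fraction {poly R}}]_n).
Hypothesis HRH : RHinf H.

Let rest k l := \prod_(p | p != (k, l)) tf_den (H p.1 p.2).

Let tfm_denE k l : tfm_den H = tf_den (H k l) * rest k l.
Proof. by rewrite /tfm_den (bigD1 (k, l)). Qed.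

Let hurwitz_den k l : hurwitz (tf_den (H k l)).
Proof. by case: (HRH k l). Qed.

Let hurwitz_rest k l : hurwitz (rest k l).
Proof. by apply: hurwitz_prod => p _. Qed.

Lemma hurwitz_tfm_den : hurwitz (tfm_den H).
Proof. by apply: hurwitz_prod => p _. Qed.

Let size_den k l :
  (size (tfm_den H)).-1 = ((size (tf_den (H k l))).-1 + (size (rest k l)).-1)%N.
Proof.
have d0 := hurwitz_neq0 (@hurwitz_den k l); have r0 := hurwitz_neq0 (@hurwitz_rest k l).
rewrite (tfm_denE k l) size_mul//; move: d0 r0; rewrite -!size_poly_gt0.
by case: (size _) => // a _; case: (size _) => // b _; rewrite /= addnS.
Qed.

Lemma size_tfm_num k l : (size (tfm_num H k l) <= size (tfm_den H))%N.
Proof.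
have d0 := hurwitz_neq0 (@hurwitz_den k l); have r0 := hurwitz_neq0 (@hurwitz_rest k l).
rewrite mxE (tfm_denE k l) [X in (_ <= X)%N]size_mul//.
apply: leq_trans (size_polyMleq _ _) _.
by rewrite -!subn1 leq_sub2r// leq_add2r; case: (HRH k l).
Qed.

(** The restriction to the closed right half-plane ensures that the denominators and cofactors being
    cancelled do not vanish at [s]. *)
Lemma tfm_evalE s : 0 <= complex.Re s ->
  tfm_eval H s = (cpoly (tfm_den H)).[s]^-1 *: cmx_eval (tfm_num H) s.
Proof.
move=> s0; apply/matrixP => k l; rewrite !mxE /tf_eval (tfm_denE k l) !rmorphM /= !hornerM.
have := hurwitz_horner (@hurwitz_den k l) s0; have := hurwitz_horner (@hurwitz_rest k l) s0.
rewrite -/(rest k l); set a := (cpoly (tf_den _)).[s]; set b := (cpoly (rest _ _)).[s].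
by move=> b0 a0; field; rewrite a0 b0.
Qed.

Lemma tfm_inftyE :
  tfm_infty H = map_mx rc
    (map_mx (fun p : {poly R} => p`_(size (tfm_den H)).-1 / lead_coef (tfm_den H)) (tfm_num H)).
Proof.
apply/matrixP => k l; rewrite !mxE (size_den k l) (tfm_denE k l) lead_coefM /tf_infty.
have d0 := hurwitz_neq0 (@hurwitz_den k l); have r0 := hurwitz_neq0 (@hurwitz_rest k l).
rewrite coefM_size; last 2 first.
- by rewrite prednK ?size_poly_gt0//; case: (HRH k l).
- by rewrite prednK ?size_poly_gt0.
rewrite -/(rest k l) -[(rest k l)`_ _]/(lead_coef (rest k l)) -lead_coef_eq0 in r0 *.
by rewrite -lead_coef_eq0 in d0; congr rc; field; rewrite d0 r0.
Qed.

Hypothesis Hfin : forall omega : R, 0 <= omega ->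
  forall tau : R, 0 < tau -> tau <= 1 ->
    ~ dilate tau (SRG (tfm_eval H (Complex 0 omega))) (-1).
Hypothesis Hinf : forall tau : R, 0 < tau -> tau <= 1 ->
  ~ dilate tau (SRG (tfm_infty H)) (-1).

Let det_infty t : 0 < t <= 1 -> \det (1%:M + t *: map_mx (fun p : {poly R} =>
  p`_(size (tfm_den H)).-1 / lead_coef (tfm_den H)) (tfm_num H)) != 0.
Proof.
move=> /andP[t0 t1]; have := SRG_det t0 (Hinf t0 t1).
rewrite tfm_inftyE -map_mxZ -(rmorph1 rc) -map_scalar_mx -map_mxD det_map_mx.
by rewrite fmorph_eq0.
Qed.

(** The coefficient at [n * deg D] is nonzero by the condition at infinity for tau = 1. This full
    degree is what later makes the closed loop proper. *)
Lemma size_return_difference :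
  ((n * (size (tfm_den H)).-1).+1 <= size (\det ((tfm_den H)%:M + tfm_num H)))%N.
Proof.
rewrite ltnNge; apply/negP => /(nth_default 0)/eqP; apply/negP.
rewrite -{1}[tfm_num H]scale1r coef_det_pencil ?(hurwitz_neq0 hurwitz_tfm_den)//.
  rewrite mulf_neq0 ?expf_neq0 ?lead_coef_eq0 ?(hurwitz_neq0 hurwitz_tfm_den)//.
  by rewrite det_infty// ltr01 lexx.
exact: size_tfm_num.
Qed.

Lemma hurwitz_return_difference : hurwitz (\det ((tfm_den H)%:M + tfm_num H)).
Proof.
apply: hurwitz_det; first exact: hurwitz_tfm_den.
- exact: size_tfm_num.
- move=> w t w0 /andP[t0 t1]; rewrite -tfm_evalE ?lexx//.
  by apply: SRG_det => //; apply: Hfin.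
- exact: det_infty.
Qed.

End CommonDenominator.

(** * Exponential kernels and causal convolution *)

Section RealIntegrable.
Variables (R : realType) (D : set (measurableTypeR R)).
Hypothesis mD : measurable D.
Implicit Types f g : R -> R.
Notation L1 f := (mu.-integrable D (EFin \o f)).

Lemma L1Zl c f : L1 f -> L1 (fun t => c * f t).
Proof. by move=> hf; apply: eq_integrable (integrableZl mD c hf) => // t _; rewrite /= EFinM. Qed.

Lemma L1Zr c f : L1 f -> L1 (fun t => f t * c).
Proof.
move=> /(L1Zl c); have -> // : (fun t => c * f t) = (fun t => f t * c).
by apply/funext => t; rewrite mulrC.
Qed.

Lemma L1D f g : L1 f -> L1 g -> L1 (fun t => f t + g t).
Proof. by move=> hf hg; apply: eq_integrable (integrableD mD hf hg) => // t _; rewrite /= EFinD. Qed.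

Lemma L1B f g : L1 f -> L1 g -> L1 (fun t => f t - g t).
Proof. by move=> hf hg; apply: eq_integrable (integrableB mD hf hg) => // t _; rewrite /= EFinB. Qed.

Lemma L1_measurable f : L1 f -> measurable_fun D f.
Proof. by case/integrableP => /measurable_EFinP. Qed.

Lemma le_L1 f g : measurable_fun D f -> (forall t, D t -> `|f t| <= g t) -> L1 g -> L1 f.
Proof.
move=> mf fg; apply: le_integrable => //; first by apply/measurable_EFinP.
by move=> t /fg h; rewrite lee_fin (le_trans h)// ler_norm.
Qed.

Lemma L1_fineK f : L1 f -> ((\int[mu]_(t in D) f t)%:E = \int[mu]_(t in D) (f t)%:E)%E.
Proof. by move=> hf; rewrite /Rintegral fineK//; exact: integrable_fin_num. Qed.

Lemma L1_lty f : L1 f -> (\int[mu]_(t in D) (f t)%:E < +oo)%E.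
Proof. by move=> hf; rewrite -L1_fineK// ltry. Qed.

Lemma L1P f : (forall t, D t -> 0 <= f t) -> measurable_fun D f ->
  (\int[mu]_(t in D) (f t)%:E < +oo)%E -> L1 f.
Proof.
move=> f0 mf h; apply/integrableP; split; first exact/measurable_EFinP.
by under eq_integral => t /set_mem/f0 ft do rewrite /= ger0_norm//.
Qed.

End RealIntegrable.

(* The library's improper fundamental theorem is for nonnegative integrands: apply it to
   [h] and [f + h]. *)
Lemma dominated_FTC2y (R : realType) (f F h K : R -> R) (a l m : R) :
  (forall x, a <= x -> `|f x| <= h x) -> continuous f -> continuous h ->
  (forall x : R, is_derive x 1 F (f x)) -> (forall x : R, is_derive x 1 K (h x)) ->
  F x @[x --> +oo] --> l -> K x @[x --> +oo] --> m ->
  mu.-integrable `[a, +oo[ (EFin \o f) /\ \int[mu]_(x in `[a, +oo[) f x = l - F a.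
Proof.
move=> fh cf ch dF dK Fl Km.
have FTC (g G : R -> R) (k : R) : (forall x, a <= x -> 0 <= g x) -> continuous g ->
    (forall x : R, is_derive x 1 G (g x)) -> G x @[x --> +oo] --> k ->
    (\int[mu]_(x in `[a, +oo[) (g x)%:E = k%:E - (G a)%:E)%E.
  move=> g0 cg dG Gk; apply: ge0_continuous_FTC2y => //.
  - exact: continuous_subspaceT.
  - apply: cvg_at_right_filter; apply: differentiable_continuous.
    by apply/derivable1_diffP; case: (dG a).
  - by move=> x _; rewrite derive1E; apply: derive_val.
have mf (g : R -> R) : continuous g -> measurable_fun `[a, +oo[ g.
  by move=> cg; apply: measurable_funTS; apply: continuous_measurable_fun.
have hint : mu.-integrable `[a, +oo[ (EFin \o h).
  apply/integrableP; split; first by apply/measurable_EFinP; exact: mf.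
  under eq_integral => x.
    rewrite inE /= in_itv /= andbT => ax.
    rewrite ger0_norm ?(le_trans _ (fh _ ax))//; over.
  by rewrite (FTC h K m)// => [|x ax]; rewrite ?ltry// (le_trans _ (fh _ ax)).
have fint : mu.-integrable `[a, +oo[ (EFin \o f).
  apply: le_integrable hint => //; first by apply/measurable_EFinP; exact: mf.
  move=> x; rewrite /= in_itv /= andbT => ax.
  by rewrite lee_fin (le_trans (fh _ ax))// ler_norm.
split=> //.
have : \int[mu]_(x in `[a, +oo[) (f x + h x) = l + m - (F a + K a).
  rewrite /Rintegral (FTC _ (F \+ K) (l + m))//.
  - by move=> x /fh; rewrite ler_norml => /andP[]; lra.
  - by move=> x; apply: cvgD; [exact: cf|exact: ch].
  - exact: cvgD.
have : \int[mu]_(x in `[a, +oo[) h x = m - K a.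
  rewrite /Rintegral (FTC h K m)// => x ax; exact: le_trans (fh _ ax).
by rewrite RintegralD//; lra.
Qed.

(** The functions [g c1 c2] form a family closed under differentiation, which acts on the
    coefficient pair by an invertible linear map of determinant [a ^ 2 + b ^ 2]. An antiderivative
    is therefore again in the family and vanishes at infinity, so the integral is minus its value at
    [tau]. The bound on the coefficients gives domination by [expR (a * x)]. *)
Lemma expR_cos_sin_kernel (R : realType) (a b c1 c2 : R) (tau : R) : a < 0 ->
  let g c1 c2 x := expR (a * x) * (c1 * cos (b * x) + c2 * sin (b * x)) in
  c1 ^+ 2 + c2 ^+ 2 <= 1 ->
  mu.-integrable `[tau, +oo[ (EFin \o (fun t => g c1 c2 (t - tau))) /\
  \int[mu]_(t in `[tau, +oo[) g c1 c2 (t - tau) = - (a * c1 - b * c2) / (a ^+ 2 + b ^+ 2).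
Proof.
move=> a0 g c12.
have cs1 c c' x : `|c * cos x + c' * sin x| <= Num.sqrt (c ^+ 2 + c' ^+ 2).
  rewrite -sqrtr_sqr; apply: ler_wsqrtr.
  have := cos2Dsin2 x; set u := cos x; set v := sin x => uv.
  have -> : c ^+ 2 + c' ^+ 2 = (c ^+ 2 + c' ^+ 2) * (u ^+ 2 + v ^+ 2) by rewrite uv mulr1.
  rewrite -subr_ge0 [X in 0 <= X](_ : _ = (c * v - c' * u) ^+ 2) ?sqr_ge0//; ring.
have gb c c' x : `|g c c' x| <= Num.sqrt (c ^+ 2 + c' ^+ 2) * expR (a * x).
  by rewrite normrM ger0_norm ?expR_ge0// mulrC ler_wpM2r ?expR_ge0 ?cs1.
have d0 : a ^+ 2 + b ^+ 2 != 0.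
  by apply: lt0r_neq0; rewrite ltr_pwDl ?sqr_ge0// exprn_even_gt0/= ?ltr0_neq0.
have dlin (f : R -> R) k (t v : R) : is_derive (k * (t - tau)) 1 f v ->
    is_derive t 1 (fun t => f (k * (t - tau))) (v * k).
  move=> df; have dh : is_derive t 1 (fun t => k * (t - tau)) k.
    by apply: is_derive_eq; rewrite subr0; exact: mulr1.
  exact: (@is_derive1_comp _ f (fun t => k * (t - tau)) t v k df dh).
have dg c c' (t : R) : is_derive t 1 (fun t => g c c' (t - tau)) (g (a * c + b * c') (a * c' - b * c) (t - tau)).
  have hE := dlin expR a t _ (is_derive_expR _).
  have hc := is_deriveZ c (dlin cos b t _ (is_derive_cos _)).
  have hs := is_deriveZ c' (dlin sin b t _ (is_derive_sin _)).
  apply: (is_derive_eq (is_deriveM hE (is_deriveD hc hs))).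
  rewrite /g /GRing.scale /= /GRing.scale /=.
  rewrite [X in _ + X * _ = _](_ : _ = c * cos (b * (t - tau)) + c' * sin (b * (t - tau)))//.
  ring.
have cg c c' : continuous (fun t => g c c' (t - tau)).
  move=> t; apply: differentiable_continuous; apply/derivable1_diffP.
  by case: (dg c c' t).
have e0 : expR (a * (x - tau)) @[x --> +oo] --> 0.
  have -> : (fun x => expR (a * (x - tau))) = (fun x => expR (- (- a * (x - tau)))).
    by apply/funext => x; rewrite mulNr opprK.
  have h1 : - a * (x - tau) @[x --> +oo] --> +oo.
    under eq_fun do rewrite mulrC.
    by apply: gt0_cvgMly; [rewrite oppr_gt0|exact: cvg_addrr].
  exact: (cvg_comp _ _ h1 (@cvgr_expR R)).
have g0 c c' : g c c' (x - tau) @[x --> +oo] --> 0.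
  apply: norm_cvg0.
  have h : Num.sqrt (c ^+ 2 + c' ^+ 2) * expR (a * (x - tau)) @[x --> +oo] --> 0.
    by rewrite -(mulr0 (Num.sqrt (c ^+ 2 + c' ^+ 2))); apply: cvgM e0; exact: cvg_cst.
  apply: (squeeze_cvgr _ (cvg_cst 0) h); apply: nearW => x.
  by rewrite normr_ge0 /= gb.
set n2 := a ^+ 2 + b ^+ 2 in d0 *.
(* The coefficients are the preimage of the pair [c1], [c2] under the derivative map of [dg]. *)
pose F t := g ((a * c1 - b * c2) / n2) ((a * c2 + b * c1) / n2) (t - tau).
have dF (t : R) : is_derive t 1 F (g c1 c2 (t - tau)).
  apply: (is_derive_eq (dg _ _ t)); congr (g _ _ _); rewrite /n2; field; exact: d0.
have dK (t : R) : is_derive t 1 (fun t => a^-1 * expR (a * (t - tau))) (expR (a * (t - tau))).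
  apply: (is_derive_eq (is_deriveZ a^-1 (dlin expR a t _ (is_derive_expR _)))).
  by rewrite /GRing.scale /=; field; rewrite lt_eqF.
have Km : a^-1 * expR (a * (x - tau)) @[x --> +oo] --> 0.
  by rewrite -(mulr0 a^-1); apply: cvgM e0; exact: cvg_cst.
have gh x : tau <= x -> `|g c1 c2 (x - tau)| <= expR (a * (x - tau)).
  move=> _; apply: le_trans (gb _ _ _) _; rewrite ler_piMl ?expR_ge0//.
  by rewrite -sqrtr1 ler_wsqrtr.
have ch : continuous (fun t => expR (a * (t - tau))).
  move=> t; apply: differentiable_continuous; apply/derivable1_diffP.
  by case: (dlin expR a t _ (is_derive_expR _)).
have [intf ->] := dominated_FTC2y gh (cg c1 c2) ch dF dK (g0 _ _) Km.
by split=> //; rewrite /F /g subrr !mulr0 expR0 cos0 sin0 /n2; ring.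
Qed.

Lemma expR_kernel (R : realType) (a s : R) : 0 < a ->
  mu.-integrable `[s, +oo[ (EFin \o (fun t => expR (- a * (t - s)))) /\
  \int[mu]_(t in `[s, +oo[) expR (- a * (t - s)) = a^-1.
Proof.
move=> a0; have na : - a < 0 by rewrite oppr_lt0.
have c1 : 1 ^+ 2 + 0 ^+ 2 <= 1 :> R by rewrite expr1n expr0n addr0.
have := @expR_cos_sin_kernel R (- a) 0 1 0 s na c1.
have -> : (fun t => expR (- a * (t - s)) * (1 * cos (0 * (t - s)) + 0 * sin (0 * (t - s)))) =
   (fun t => expR (- a * (t - s))).
  by apply/funext => t; rewrite !mul0r cos0 mul1r addr0 mulr1.
move=> [hi hE]; split=> //.
by rewrite hE; field; rewrite gt_eqF.
Qed.

Lemma measurable_subr (R : realType) (s : R) : measurable_fun setT (fun t : R => t - s).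
Proof. exact: (measurable_funB (@measurable_id _ _ _) (measurable_cst s)). Qed.

Lemma measurable_subl (R : realType) (t : R) : measurable_fun setT (fun s : R => t - s).
Proof. exact: (measurable_funB (measurable_cst t) (@measurable_id _ _ _)). Qed.

Section Convolution.
Variables (R : realType) (a : R) (k G : R -> R).
Hypothesis a0 : 0 < a.
Hypothesis mk : measurable_fun setT k.
Hypothesis kexp : forall x, 0 <= x -> `|k x| <= expR (- a * x).
Hypothesis GL1 : mu.-integrable time (EFin \o G).

(** The convolution integrand extended by zero off the region [0 <= s <= t], so that Fubini can be
    used on the whole product instead of a triangle. *)
Let Phi (x : R * R) : R :=
  if x.2 <= x.1 then k (x.1 - x.2) * (G \_ time) x.2 else 0.

Let mG : measurable_fun setT (G \_ time).
Proof.
apply: (proj1 (measurable_restrictT G (measurable_itv _))).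
by case/integrableP: GL1 => /measurable_EFinP.
Qed.

Let mPhi : measurable_fun setT Phi.
Proof.
apply: measurable_fun_ifT => //.
- by apply: measurable_fun_ler; [exact: measurable_snd|exact: measurable_fst].
- apply: measurable_funM.
    apply: (measurableT_comp mk).
    by apply: measurable_funB; [exact: measurable_fst|exact: measurable_snd].
  exact: (measurableT_comp mG measurable_snd).
Qed.

Let mks (s : R) : measurable_fun `[s, +oo[ (fun t => k (t - s)).
Proof.
by apply: measurable_funTS; apply: (measurableT_comp mk); exact: measurable_subr.
Qed.

Let ks_integrable (s : R) : mu.-integrable `[s, +oo[ (EFin \o (fun t => k (t - s))).
Proof.
apply: le_integrable (expR_kernel s a0).1 => //; first by apply/measurable_EFinP; exact: mks.
move=> t; rewrite /= in_itv /= andbT => st.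
by rewrite lee_fin (le_trans (kexp _)) ?subr_ge0// ler_norm.
Qed.

Let Phi_s (s : R) : 0 <= s ->
  (fun t => Phi (t, s)) = (fun t => k (t - s) * G s) \_ [set` `[s, +oo[].
Proof.
move=> s0; apply/funext => t; rewrite /Phi /patch /= !mem_setE !in_itv /= !andbT s0.
by [].
Qed.

Let Phi_neg (t s : R) : s < 0 -> Phi (t, s) = 0.
Proof.
move=> s0; rewrite /Phi /patch /= mem_setE in_itv /= andbT [0 <= s]leNgt s0 mulr0.
by case: ifP.
Qed.

Let Phi_t (t : R) :
  (fun s => Phi (t, s)) = (fun s => k (t - s) * G s) \_ [set` `[0, t]].
Proof.
apply/funext => s; rewrite /Phi /patch /= !mem_setE !in_itv /= !andbT.
by case: (s <= t); case: (0 <= s); rewrite ?mulr0.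
Qed.

(** Tonelli: for fixed [s] the integral of the absolute value over [t] is at most [a^-1 * |G s|], by
    the exponential bound on the kernel, and this is integrable in [s]. *)
Let Phi_integrable : (mu \x mu)%E.-integrable setT (EFin \o Phi).
Proof.
have mPhi' : measurable_fun setT (EFin \o Phi) by apply/measurable_EFinP; exact: mPhi.
apply: (proj2 (integrable21ltyP mu mu mPhi')).
have inner (s : R) : (\int[mu]_t `|(EFin \o Phi) (t, s)| <=
    ((fun s => (a^-1 * `|G s|)%:E) \_ time) s)%E.
  have [s0|s0] := leP 0 s; last first.
    rewrite integral0_eq => [|t _]; last by rewrite /= Phi_neg// normr0.
    by rewrite /patch; case: ifP => // _; rewrite lee_fin mulr_ge0// invr_ge0 ltW.
  rewrite patchE mem_setE in_itv /= andbT s0.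
  rewrite (_ : (fun t => _) = (fun t => (`|k (t - s)| * `|G s|)%:E) \_ [set` `[s, +oo[]); last first.
    apply/funext => t; have := congr1 (fun f => f t) (Phi_s s0); rewrite /= /patch => ->.
    by case: ifP => _; rewrite ?normr0 ?normrM.
  rewrite -integral_mkcond -(expR_kernel s a0).2.
  rewrite -RintegralZr ?(expR_kernel s a0).1//.
  rewrite L1_fineK//; last by apply: L1Zr => //; exact: (expR_kernel s a0).1.
  apply: ge0_le_integral => //.
  - apply/measurable_EFinP; apply: measurable_funM => //.
    by apply: measurableT_comp => //; exact: mks.
  - apply/measurable_EFinP; apply: measurable_funM => //.
    exact: (L1_measurable (expR_kernel s a0).1).
  - move=> t; rewrite /= in_itv /= andbT => st.
    by rewrite lee_fin ler_wpM2r// kexp// subr_ge0.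
have mt : measurable (time : set (measurableTypeR R)) by exact: measurable_itv.
have GZ := L1Zl mt a^-1 (integrable_norm GL1).
apply: le_lt_trans (_ : (\int[mu]_s ((fun s => (a^-1 * `|G s|)%:E) \_ time) s < +oo)%E).
  apply: ge0_le_integral => //.
  - by move=> s _; apply: integral_ge0.
  - pose A (x : measurableTypeR R * measurableTypeR R) := `|(Phi x)%:E|%E.
    have mA : measurable_fun setT A by apply: measurableT_comp.
    exact: (@measurable_fun_fubini_tonelli_G _ _ _ _ _ mu A mA (fun x => abse_ge0 _)).
  - by case/integrableP: ((integrable_mkcond _ mt).1 GZ).
by rewrite -integral_mkcond; apply: L1_lty.
Qed.

Let w (t : R) := \int[mu]_(s in `[0, t]) (k (t - s) * G s).

Lemma conv_section_integrable (t : R) :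
  mu.-integrable `[0, t] (EFin \o (fun s => k (t - s) * G s)).
Proof.
have GL : mu.-integrable `[0, t] (EFin \o G).
  apply: integrableS GL1 => //.
  by move=> s; rewrite /= !in_itv /= andbT => /andP[].
have mGL := L1_measurable GL.
apply: le_integrable GL => //.
  apply/measurable_EFinP; apply: measurable_funM.
    by apply: measurable_funTS; apply: (measurableT_comp mk); exact: measurable_subl.
  exact: mGL.
move=> s; rewrite /= in_itv /= => /andP[s0 st].
rewrite lee_fin normrM ler_piMl// (le_trans (kexp _)) ?subr_ge0//.
by rewrite -[leRHS]expR0 ler_expR mulNr oppr_le0 mulr_ge0 ?subr_ge0 ?(ltW a0).
Qed.

Let Fw (t : R) : (\int[mu]_s (EFin \o Phi) (t, s) = (w t)%:E)%E.
Proof.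
rewrite -[X in integral _ _ X]/(EFin \o (fun s => Phi (t, s))) Phi_t -restrict_EFin.
rewrite -integral_mkcond /w L1_fineK//.
exact: conv_section_integrable.
Qed.

Lemma conv_integrable : mu.-integrable time (EFin \o w).
Proof.
have h : mu.-integrable setT (EFin \o w).
  by apply: eq_integrable (integrable_fubini_F Phi_integrable) => // t _; exact: Fw.
exact: integrableS h.
Qed.

(** Swapping the integrals leaves, for each [s], the total mass [c] of the translated kernel. This
    is the convolution theorem at frequency zero; the other frequencies reduce to it by absorbing
    the exponential into the kernel. *)
Lemma integral_conv c : (forall s, 0 <= s -> \int[mu]_(t in `[s, +oo[) k (t - s) = c) ->
  \int[mu]_(t in time) w t = c * \int[mu]_(s in time) G s.
Proof.
move=> kc; rewrite -RintegralZl// {1}/Rintegral; congr fine.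
transitivity (\int[mu]_t (w t)%:E)%E.
  rewrite [LHS]integral_mkcond; apply: eq_integral => t _; rewrite patchE mem_setE in_itv /= andbT.
  case: leP => // t0; rewrite /w set_itv_ge ?Rintegral_set0//.
  by rewrite bnd_simp -ltNge.
transitivity (\int[mu]_t \int[mu]_s (EFin \o Phi) (t, s))%E.
  by apply: eq_integral => t _; rewrite Fw.
rewrite (Fubini Phi_integrable) [RHS]integral_mkcond; apply: eq_integral => s _.
rewrite patchE mem_setE in_itv /= andbT; case: leP => s0; last first.
  by rewrite integral0_eq// => t _; rewrite /= Phi_neg.
rewrite -[X in integral _ _ X]/(EFin \o (fun t => Phi (t, s))) Phi_s// -restrict_EFin.
rewrite -integral_mkcond -(kc s s0) -RintegralZr// L1_fineK//.
exact: L1Zr.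
Qed.

End Convolution.

Lemma measurable_time (R : realType) : measurable (time : set (measurableTypeR R)).
Proof. exact: measurable_itv. Qed.

Lemma measurable_0t (R : realType) (t : R) : measurable (`[0, t] : set (measurableTypeR R)).
Proof. exact: measurable_itv. Qed.

#[local] Hint Resolve measurable_time measurable_0t : core.

(** * Square-integrable functions on the half-line and their convolutions *)

Definition rL2 (R : realType) (g : R -> R) : Prop :=
  measurable_fun time g /\ mu.-integrable time (EFin \o (fun t => g t ^+ 2)).

Section RealL2.
Variable R : realType.
Implicit Types g h k : R -> R.

Lemma le_rL2 g h : measurable_fun time g ->
  mu.-integrable time (EFin \o h) -> (forall t, 0 <= t -> g t ^+ 2 <= h t) -> rL2 g.
Proof.
move=> mg hh gh; split=> //; apply: le_L1 hh => //.
  exact: measurable_funX.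
move=> t; rewrite /= in_itv /= andbT => t0.
by rewrite ger0_norm ?sqr_ge0// gh.
Qed.

Lemma rL2D g h : rL2 g -> rL2 h -> rL2 (fun t => g t + h t).
Proof.
move=> [mg ig] [mh ih].
apply: (le_rL2 _ (L1Zl (@measurable_time R) 2 (L1D (@measurable_time R) ig ih))).
  exact: measurable_funD.
by move=> t _; have := sqr_ge0 (g t - h t); nra.
Qed.

Lemma rL2Zl c g : rL2 g -> rL2 (fun t => c * g t).
Proof.
move=> [mg ig]; apply: (le_rL2 _ (L1Zl (@measurable_time R) (c ^+ 2) ig)).
  exact: measurable_funM.
by move=> t _; rewrite exprMn.
Qed.

Lemma rL2B g h : rL2 g -> rL2 h -> rL2 (fun t => g t - h t).
Proof.
move=> hg hh; rewrite (_ : (fun t => _) = (fun t => g t + -1 * h t)); first exact: rL2D hg (rL2Zl (-1) hh).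
by apply/funext => t; rewrite mulN1r.
Qed.

(** The product of the exponential and [g] is dominated by the sum of their squares, both
    integrable. *)
Lemma rL2_exp_L1 s g : 0 < s -> rL2 g ->
  mu.-integrable time (EFin \o (fun t => expR (- s * t) * g t)).
Proof.
move=> s0 [mg ig].
have s2 : 0 < s * 2 by rewrite mulr_gt0.
have ek := (expR_kernel 0 s2).1.
apply: le_L1 (L1D (@measurable_time R) ek ig) => //.
  apply: measurable_funM => //; apply: measurable_funTS.
  by apply: measurableT_comp => //; exact: measurable_funM.
move=> t _; rewrite subr0.
have -> : expR (- (s * 2) * t) = expR (- s * t) ^+ 2.
  by rewrite expr2 -expRD; congr expR; ring.
rewrite normrM -[X in _ <= X + _]real_normK ?num_real// -[X in _ <= _ + X]real_normK ?num_real//.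
have := sqr_ge0 (`|expR (- s * t)| - `|g t|); have := sqr_ge0 (`|g t|).
have := sqr_ge0 (`|expR (- s * t)|); nra.
Qed.

Lemma integral_expR_0t (a t : R) : 0 < a -> 0 <= t ->
  mu.-integrable `[0, t] (EFin \o (fun s => expR (- a * (t - s)))) /\
  \int[mu]_(s in `[0, t]) expR (- a * (t - s)) <= a^-1.
Proof.
move=> a0 t0.
have dE (s : R) : is_derive s 1 (fun s => a^-1 * expR (- a * (t - s))) (expR (- a * (t - s))).
  have dh : is_derive s 1 (fun s => - a * (t - s)) a.
    by apply: is_derive_eq; rewrite /GRing.scale /=; ring.
  apply: (is_derive_eq (is_deriveZ a^-1 (@is_derive1_comp _ expR _ s _ _ (is_derive_expR _) dh))).
  by rewrite /GRing.scale /=; field; rewrite gt_eqF.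
have cd (f f' : R -> R) : (forall s : R, is_derive s 1 f (f' s)) -> continuous f.
  by move=> df s; apply: differentiable_continuous; apply/derivable1_diffP; case: (df s).
have cE : continuous (fun s => expR (- a * (t - s))).
  have -> : (fun s => expR (- a * (t - s))) = (fun s => a * (a^-1 * expR (- a * (t - s)))).
    by apply/funext => s; rewrite mulVKf// gt_eqF.
  by move=> s; apply: cvgM; [exact: cvg_cst|exact: (cd _ _ dE)].
split.
  apply: continuous_compact_integrable; first exact: segment_compact.
  exact: continuous_subspaceT.
move: t0; rewrite le_eqVlt => /orP[/eqP<-|t0].
  by rewrite set_itv1 Rintegral_set1 invr_ge0 ltW.
rewrite /Rintegral (@continuous_FTC2 _ _ (fun s => a^-1 * expR (- a * (t - s))))//.
- rewrite -EFinB /= subrr mulr0 expR0 mulr1 lerBlDr lerDl mulr_ge0 ?expR_ge0//.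
  by rewrite invr_ge0 ltW.
- exact: continuous_subspaceT.
- split.
  + by move=> s _; case: (dE s).
  + by apply: cvg_at_right_filter; exact: (cd _ _ dE).
  + by apply: cvg_at_left_filter; exact: (cd _ _ dE).
- by move=> s _; rewrite derive1E; apply: derive_val.
Qed.

Lemma measurable_expRM (a : R) (D : set (measurableTypeR R)) : measurable_fun D (fun t => expR (a * t)).
Proof.
by apply: measurable_funTS; apply: measurableT_comp => //; exact: measurable_funM.
Qed.

Section ConvolutionL2.
Variables (a : R) (k g : R -> R).
Hypothesis a0 : 0 < a.
Hypothesis mk : measurable_fun setT k.
Hypothesis kexp : forall x, 0 <= x -> `|k x| <= expR (- a * x).
Hypothesis gL2 : rL2 g.

(** A square-integrable [g] need not be integrable, so the previous section does not apply to it
    directly. Weighting kernel and signal by the same decaying exponential makes [g1] integrable,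
    and [kg1] shows that the weights factor out of the convolution as [expR t]. *)
Let k1 x := expR (- 1 * x) * k x.
Let g1 s := expR (- 1 * s) * g s.

Let mk1 : measurable_fun setT k1.
Proof. by apply: measurable_funM => //; exact: measurable_expRM. Qed.

Let k1exp x : 0 <= x -> `|k1 x| <= expR (- a * x).
Proof.
move=> x0; rewrite /k1 normrM ger0_norm ?expR_ge0//.
apply: le_trans (kexp x0); rewrite ler_piMl//.
by rewrite -[leRHS]expR0 ler_expR mulN1r oppr_le0.
Qed.

Let g1L1 : mu.-integrable time (EFin \o g1).
Proof. exact: rL2_exp_L1. Qed.

Let kg1 t s : expR t * (k1 (t - s) * g1 s) = k (t - s) * g s.
Proof.
rewrite /k1 /g1 (_ : _ * _ = expR t * expR (- 1 * (t - s)) * expR (- 1 * s) * (k (t - s) * g s)).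
  by rewrite -!expRD (_ : _ + _ = 0) ?expR0 ?mul1r//; ring.
ring.
Qed.

Lemma rL2_section_integrable t :
  mu.-integrable `[0, t] (EFin \o (fun s => k (t - s) * g s)).
Proof.
have h := L1Zl (measurable_0t t) (expR t) (conv_section_integrable a0 mk1 k1exp g1L1 t).
by apply: eq_integrable h => // s _; rewrite /= kg1.
Qed.

Let w t := \int[mu]_(s in `[0, t]) (k (t - s) * g s).

Let mw : measurable_fun time w.
Proof.
have h := L1_measurable (conv_integrable a0 mk1 k1exp g1L1).
have -> : w = (fun t => expR (1 * t) * \int[mu]_(s in `[0, t]) (k1 (t - s) * g1 s)).
  apply/funext => t; rewrite -RintegralZl//; last exact: (conv_section_integrable a0 mk1 k1exp g1L1 t).
  by apply: eq_Rintegral => s _; rewrite mul1r -kg1.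
have h1 : measurable_fun time (fun t : R => expR (1 * t)) by exact: measurable_expRM.
exact: measurable_funM h1 h.
Qed.

(* Cauchy-Schwarz for the weight [expR (- a * (t - s))], whose mass is at most [a^-1]. *)
Let w_bound t : 0 <= t ->
  w t ^+ 2 <= a^-1 * \int[mu]_(s in `[0, t]) (expR (- a * (t - s)) * g s ^+ 2).
Proof.
move=> t0; set Q := \int[mu]_(s in `[0, t]) (expR (- a * (t - s)) * g s ^+ 2).
have [Ei El] := integral_expR_0t a0 t0.
have me : measurable_fun setT (fun x => expR (- a * x)) by exact: measurable_expRM.
have ee x : 0 <= x -> `|expR (- a * x)| <= expR (- a * x).
  by move=> _; rewrite ger0_norm ?expR_ge0.
have Qi := conv_section_integrable a0 me ee gL2.2 t.
have wi := rL2_section_integrable t.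
have Q0 : 0 <= Q by apply: Rintegral_ge0 => s _; rewrite mulr_ge0 ?expR_ge0 ?sqr_ge0.
(* Cauchy-Schwarz in the parametrised form [2 y <= c + y ^ 2 / c], integrated against the weight.
   The later choice [c = a * |w t|] makes [c / a = |w t|] and leaves [|w t| ^ 2 <= Q / a]. *)
have key c : 0 < c -> `|w t| * 2 <= c * a^-1 + Q / c.
  move=> c0.
  have h1 : `|w t| * 2 <= \int[mu]_(s in `[0, t])
      (c * expR (- a * (t - s)) + (expR (- a * (t - s)) * g s ^+ 2) / c).
    apply: le_trans (_ : \int[mu]_(s in `[0, t]) (`|k (t - s) * g s| * 2) <= _).
      rewrite RintegralZr//; last exact: integrable_norm.
      by rewrite ler_wpM2r//; exact: le_normr_Rintegral.
    apply: le_Rintegral => //.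
    - by apply: L1Zr => //; exact: integrable_norm.
    - by apply: L1D => //; [exact: L1Zl|exact: L1Zr].
    - move=> s; rewrite /= in_itv /= => /andP[s0 st].
      have h : `|k (t - s)| <= expR (- a * (t - s)) by apply: kexp; rewrite subr_ge0.
      rewrite normrM; set e := expR _ in h *; have e0 : 0 < e by exact: expR_gt0.
      apply: le_trans (_ : e * `|g s| * 2 <= _); first by rewrite !ler_wpM2r.
      rewrite -[g s ^+ 2]real_normK ?num_real//; set y := `|g s|.
      have -> : c * e + e * y ^+ 2 / c = e * y * 2 + e * (c - y) ^+ 2 / c.
        by field; rewrite gt_eqF.
      by rewrite lerDl; apply: divr_ge0 (ltW c0); apply: mulr_ge0 (ltW e0) (sqr_ge0 _).
  apply: le_trans h1 _.
  rewrite RintegralD//; [|exact: L1Zl|exact: L1Zr].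
  by rewrite RintegralZl// RintegralZr// lerD2r ler_wpM2l// ltW.
rewrite -real_normK ?num_real//.
have [->|wn] := eqVneq (w t) 0.
  by rewrite normr0 expr0n /= mulr_ge0 ?invr_ge0 ?(ltW a0).
have wp : 0 < `|w t| by rewrite normr_gt0.
have := key (a * `|w t|) (mulr_gt0 a0 wp).
have -> : a * `|w t| * a^-1 = `|w t| by field; rewrite gt_eqF.
rewrite -lerBlDl (_ : `|w t| * 2 - `|w t| = `|w t|); last by ring.
rewrite ler_pdivlMr ?mulr_gt0// => h.
by rewrite -(ler_pM2l a0) mulVKf ?gt_eqF//; apply: le_trans h; rewrite expr2 mulrCA.
Qed.

(** By [w_bound], [w ^ 2] is dominated by a multiple of the convolution of the exponential with
    [g ^ 2]. The latter function is integrable, so [conv_integrable] applies to it. *)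
Lemma rL2_conv : rL2 w.
Proof.
have me : measurable_fun setT (fun x => expR (- a * x)) by exact: measurable_expRM.
have ee x : 0 <= x -> `|expR (- a * x)| <= expR (- a * x).
  by move=> _; rewrite ger0_norm ?expR_ge0.
exact: (le_rL2 mw (L1Zl (@measurable_time R) a^-1 (conv_integrable a0 me ee gL2.2)) w_bound).
Qed.

End ConvolutionL2.
End RealL2.

(** * Laplace transforms and rational filters *)

Definition cL1 (R : realType) (D : set (measurableTypeR R)) (f : R -> R[i]) : Prop :=
  mu.-integrable D (EFin \o (fun t => complex.Re (f t))) /\
  mu.-integrable D (EFin \o (fun t => complex.Im (f t))).

Definition cint (R : realType) (D : set (measurableTypeR R)) (f : R -> R[i]) : R[i] :=
  Complex (\int[mu]_(t in D) complex.Re (f t)) (\int[mu]_(t in D) complex.Im (f t)).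

Definition cL2 (R : realType) (f : R -> R[i]) : Prop :=
  rL2 (fun t => complex.Re (f t)) /\ rL2 (fun t => complex.Im (f t)).

Lemma cReD (R : realType) (x y : R[i]) : complex.Re (x + y) = complex.Re x + complex.Re y.
Proof. by case: x; case: y. Qed.

Lemma cImD (R : realType) (x y : R[i]) : complex.Im (x + y) = complex.Im x + complex.Im y.
Proof. by case: x; case: y. Qed.

Lemma cReM (R : realType) (x y : R[i]) :
  complex.Re (x * y) = complex.Re x * complex.Re y - complex.Im x * complex.Im y.
Proof. by case: x; case: y. Qed.

Lemma cImM (R : realType) (x y : R[i]) :
  complex.Im (x * y) = complex.Re x * complex.Im y + complex.Im x * complex.Re y.
Proof. by case: x; case: y. Qed.

Lemma complex_eq (R : realType) (x y : R[i]) :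
  complex.Re x = complex.Re y -> complex.Im x = complex.Im y -> x = y.
Proof. by case: x => a b; case: y => c d /= -> ->. Qed.

Lemma cexpD (R : realType) (x y : R[i]) : cexp (x + y) = cexp x * cexp y.
Proof.
by case: x => a b; case: y => c d; apply: complex_eq; rewrite /cexp /= expRD ?cosD ?sinD; ring.
Qed.

Section ComplexIntegral.
Variables (R : realType) (D : set (measurableTypeR R)).
Hypothesis mD : measurable D.
Implicit Types (f g : R -> R[i]) (c : R[i]).

Lemma cL1_ext f g : (forall t, D t -> f t = g t) -> cL1 D f -> cL1 D g.
Proof.
by move=> fg [h1 h2]; split; [apply: eq_integrable h1|apply: eq_integrable h2] => //
  t /set_mem/fg /= ->.
Qed.

Lemma eq_cint f g : (forall t, D t -> f t = g t) -> cint D f = cint D g.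
Proof.
by move=> fg; rewrite /cint; congr Complex; apply: eq_Rintegral => t /set_mem/fg ->.
Qed.

Lemma cL1D f g : cL1 D f -> cL1 D g -> cL1 D (fun t => f t + g t).
Proof.
move=> [f1 f2] [g1 g2]; split.
  by apply: eq_integrable (L1D mD f1 g1) => // t _; rewrite /= cReD.
by apply: eq_integrable (L1D mD f2 g2) => // t _; rewrite /= cImD.
Qed.

Lemma cintD f g : cL1 D f -> cL1 D g -> cint D (fun t => f t + g t) = cint D f + cint D g.
Proof.
move=> [f1 f2] [g1 g2]; apply: complex_eq; rewrite ?cReD ?cImD /= -RintegralD//.
  by apply: eq_Rintegral => t _; rewrite cReD.
by apply: eq_Rintegral => t _; rewrite cImD.
Qed.

Lemma cL1Z c f : cL1 D f -> cL1 D (fun t => c * f t).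
Proof.
move=> [f1 f2]; split.
  apply: eq_integrable (L1B mD (L1Zl mD (complex.Re c) f1) (L1Zl mD (complex.Im c) f2)) => //.
  by move=> t _; rewrite /= cReM.
apply: eq_integrable (L1D mD (L1Zl mD (complex.Re c) f2) (L1Zl mD (complex.Im c) f1)) => //.
by move=> t _; rewrite /= cImM.
Qed.

Lemma cintZ c f : cL1 D f -> cint D (fun t => c * f t) = c * cint D f.
Proof.
move=> [f1 f2]; apply: complex_eq; rewrite ?cReM ?cImM /=.
  rewrite -!RintegralZl// -RintegralB//; [|exact: L1Zl|exact: L1Zl].
  by apply: eq_Rintegral => t _; rewrite cReM.
rewrite -!RintegralZl// -RintegralD//; [|exact: L1Zl|exact: L1Zl].
by apply: eq_Rintegral => t _; rewrite cImM.
Qed.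

End ComplexIntegral.

Section ExponentialKernel.
Variables (R : realType) (q : R[i]).
Hypothesis q0 : complex.Re q < 0.

Definition cexp_ray (q : R[i]) (x : R) : R[i] := cexp (q * rc x).

Lemma Re_cexp_ray p x :
  complex.Re (cexp_ray p x) = expR (complex.Re p * x) * cos (complex.Im p * x).
Proof. by case: p => a b; rewrite /cexp_ray /cexp /= !mulr0 subr0 add0r. Qed.

Lemma Im_cexp_ray p x :
  complex.Im (cexp_ray p x) = expR (complex.Re p * x) * sin (complex.Im p * x).
Proof. by case: p => a b; rewrite /cexp_ray /cexp /= !mulr0 subr0 add0r. Qed.

Lemma cexp_rayD p p' x : cexp_ray (p + p') x = cexp_ray p x * cexp_ray p' x.
Proof. by rewrite /cexp_ray mulrDl cexpD. Qed.

Lemma cexp_rayDr p x y : cexp_ray p (x + y) = cexp_ray p x * cexp_ray p y.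
Proof. by rewrite /cexp_ray rmorphD mulrDr cexpD. Qed.

Lemma measurable_Re_cexp_ray p (D : set (measurableTypeR R)) :
  measurable_fun D (fun x => complex.Re (cexp_ray p x)).
Proof.
apply: measurable_funTS; under eq_fun do rewrite Re_cexp_ray.
apply: measurable_funM; first exact: measurable_expRM.
apply: measurableT_comp; last exact: measurable_funM.
by apply: continuous_measurable_fun; exact: continuous_cos.
Qed.

Lemma measurable_Im_cexp_ray p (D : set (measurableTypeR R)) :
  measurable_fun D (fun x => complex.Im (cexp_ray p x)).
Proof.
apply: measurable_funTS; under eq_fun do rewrite Im_cexp_ray.
apply: measurable_funM; first exact: measurable_expRM.
apply: measurableT_comp; last exact: measurable_funM.
by apply: continuous_measurable_fun; exact: continuous_sin.
Qed.

Lemma Re_cexp_ray_le p x : `|complex.Re (cexp_ray p x)| <= expR (complex.Re p * x).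
Proof.
rewrite Re_cexp_ray normrM ger0_norm ?expR_ge0// ler_piMr ?expR_ge0//.
by rewrite ler_norml cos_geN1 cos_le1.
Qed.

Lemma Im_cexp_ray_le p x : `|complex.Im (cexp_ray p x)| <= expR (complex.Re p * x).
Proof.
rewrite Im_cexp_ray normrM ger0_norm ?expR_ge0// ler_piMr ?expR_ge0//.
by rewrite ler_norml sin_geN1 sin_le1.
Qed.

Let a := - complex.Re q.
Let a0 : 0 < a. Proof. by rewrite oppr_gt0. Qed.
Let kc x := complex.Re (cexp_ray q x).
Let ks x := complex.Im (cexp_ray q x).
Let mkc : measurable_fun setT kc. Proof. exact: measurable_Re_cexp_ray. Qed.
Let mks : measurable_fun setT ks. Proof. exact: measurable_Im_cexp_ray. Qed.
Let kc_exp x : 0 <= x -> `|kc x| <= expR (- a * x).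
Proof. by move=> _; rewrite opprK Re_cexp_ray_le. Qed.
Let ks_exp x : 0 <= x -> `|ks x| <= expR (- a * x).
Proof. by move=> _; rewrite opprK Im_cexp_ray_le. Qed.

Let int_kc s : \int[mu]_(t in `[s, +oo[) kc (t - s) = complex.Re ((- q)^-1).
Proof.
have c1 : 1 ^+ 2 + 0 ^+ 2 <= 1 :> R by rewrite expr1n expr0n addr0.
have [_ h] := @expR_cos_sin_kernel R _ (complex.Im q) 1 0 s q0 c1.
rewrite (_ : complex.Re ((- q)^-1) = - (complex.Re q * 1 - complex.Im q * 0) /
   (complex.Re q ^+ 2 + complex.Im q ^+ 2)).
  rewrite -h; apply: eq_Rintegral => t _.
  by rewrite /kc Re_cexp_ray mul1r mul0r addr0.
by case: (q) => x y /=; rewrite !sqrrN mulr1 mulr0 subr0.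
Qed.

Let int_ks s : \int[mu]_(t in `[s, +oo[) ks (t - s) = complex.Im ((- q)^-1).
Proof.
have c1 : 0 ^+ 2 + 1 ^+ 2 <= 1 :> R by rewrite expr1n expr0n add0r.
have [_ h] := @expR_cos_sin_kernel R _ (complex.Im q) 0 1 s q0 c1.
rewrite (_ : complex.Im ((- q)^-1) = - (complex.Re q * 0 - complex.Im q * 1) /
   (complex.Re q ^+ 2 + complex.Im q ^+ 2)).
  rewrite -h; apply: eq_Rintegral => t _.
  by rewrite /ks Im_cexp_ray mul1r mul0r add0r.
by case: (q) => x y /=; rewrite !sqrrN mulr1 mulr0 sub0r !mulNr.
Qed.

Definition cconv (q : R[i]) (V : R -> R[i]) (t : R) : R[i] :=
  cint `[0, t] (fun s => cexp_ray q (t - s) * V s).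

Let sec (V : R -> R[i]) t := [/\
  mu.-integrable `[0, t] (EFin \o (fun s => kc (t - s) * complex.Re (V s))),
  mu.-integrable `[0, t] (EFin \o (fun s => ks (t - s) * complex.Im (V s))),
  mu.-integrable `[0, t] (EFin \o (fun s => kc (t - s) * complex.Im (V s))) &
  mu.-integrable `[0, t] (EFin \o (fun s => ks (t - s) * complex.Re (V s)))].

Let cconv_sec V t : sec V t -> cL1 `[0, t] (fun s => cexp_ray q (t - s) * V s) /\
  cconv q V t = Complex
   (\int[mu]_(s in `[0, t]) (kc (t - s) * complex.Re (V s)) -
    \int[mu]_(s in `[0, t]) (ks (t - s) * complex.Im (V s)))
   (\int[mu]_(s in `[0, t]) (kc (t - s) * complex.Im (V s)) +
    \int[mu]_(s in `[0, t]) (ks (t - s) * complex.Re (V s))).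
Proof.
move=> [h1 h2 h3 h4]; split.
  split.
    apply: eq_integrable (L1B (measurable_0t t) h1 h2) => // s _.
    by rewrite /= cReM.
  apply: eq_integrable (L1D (measurable_0t t) h3 h4) => // s _.
  by rewrite /= cImM.
rewrite -RintegralB// -RintegralD// /cconv /cint; congr Complex.
  by apply: eq_Rintegral => s _; rewrite cReM.
by apply: eq_Rintegral => s _; rewrite cImM.
Qed.

(** The kernel [exp (q x)] has integral [(- q)^-1] over the half-line, and [integral_conv] applies
    to the four real convolutions that make up the complex one. *)
Lemma cint_cconv V : cL1 time V ->
  cL1 time (cconv q V) /\ cint time (cconv q V) = (- q)^-1 * cint time V.
Proof.
move=> [V1 V2].
have E t : cconv q V t = _ := (@cconv_sec V t (And4
  (conv_section_integrable a0 mkc kc_exp V1 t) (conv_section_integrable a0 mks ks_exp V2 t)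
  (conv_section_integrable a0 mkc kc_exp V2 t) (conv_section_integrable a0 mks ks_exp V1 t))).2.
have c1 := conv_integrable a0 mkc kc_exp V1; have c2 := conv_integrable a0 mkc kc_exp V2.
have s1 := conv_integrable a0 mks ks_exp V1; have s2 := conv_integrable a0 mks ks_exp V2.
have mt := @measurable_time R.
split.
  split.
    by apply: eq_integrable (L1B mt c1 s2) => // t _; rewrite /comp E.
  by apply: eq_integrable (L1D mt c2 s1) => // t _; rewrite /comp E.
have kcE s : 0 <= s -> _ := fun _ => int_kc s.
have ksE s : 0 <= s -> _ := fun _ => int_ks s.
apply: complex_eq; rewrite ?cReM ?cImM.
  transitivity (\int[mu]_(t in time)
    (\int[mu]_(s in `[0, t]) (kc (t - s) * complex.Re (V s)) -
     \int[mu]_(s in `[0, t]) (ks (t - s) * complex.Im (V s)))).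
    by apply: eq_Rintegral => t _; rewrite E.
  by rewrite RintegralB// (integral_conv a0 mkc kc_exp V1 kcE) (integral_conv a0 mks ks_exp V2 ksE).
transitivity (\int[mu]_(t in time)
  (\int[mu]_(s in `[0, t]) (kc (t - s) * complex.Im (V s)) +
   \int[mu]_(s in `[0, t]) (ks (t - s) * complex.Re (V s)))).
  by apply: eq_Rintegral => t _; rewrite E.
by rewrite RintegralD// (integral_conv a0 mkc kc_exp V2 kcE) (integral_conv a0 mks ks_exp V1 ksE).
Qed.

Lemma cL2_cconv V : cL2 V ->
  cL2 (cconv q V) /\ forall t, cL1 `[0, t] (fun s => cexp_ray q (t - s) * V s).
Proof.
move=> [V1 V2].
have E t := @cconv_sec V t (And4
  (rL2_section_integrable a0 mkc kc_exp V1 t) (rL2_section_integrable a0 mks ks_exp V2 t)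
  (rL2_section_integrable a0 mkc kc_exp V2 t) (rL2_section_integrable a0 mks ks_exp V1 t)).
split; last by move=> t; case: (E t).
have c1 := rL2_conv a0 mkc kc_exp V1; have c2 := rL2_conv a0 mkc kc_exp V2.
have s1 := rL2_conv a0 mks ks_exp V1; have s2 := rL2_conv a0 mks ks_exp V2.
split.
  rewrite (_ : (fun t => _) = (fun t =>
    \int[mu]_(s in `[0, t]) (kc (t - s) * complex.Re (V s)) -
    \int[mu]_(s in `[0, t]) (ks (t - s) * complex.Im (V s)))); first exact: rL2B.
  by apply/funext => t; rewrite (E t).2.
rewrite (_ : (fun t => _) = (fun t =>
    \int[mu]_(s in `[0, t]) (kc (t - s) * complex.Im (V s)) +
    \int[mu]_(s in `[0, t]) (ks (t - s) * complex.Re (V s)))); first exact: rL2D.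
by apply/funext => t; rewrite (E t).2.
Qed.

End ExponentialKernel.

(** * Laplace transforms of scalar signals *)

Definition slaplace (R : realType) (v : R -> R[i]) (s : R[i]) : R[i] :=
  cint time (fun t => cexp_ray (- s) t * v t).

Section ScalarLaplace.
Variable R : realType.
Implicit Types (v w : R -> R[i]) (s p : R[i]).
Let mt := @measurable_time R.

Lemma cL2D v w : cL2 v -> cL2 w -> cL2 (fun t => v t + w t).
Proof.
move=> [v1 v2] [w1 w2]; split.
  by rewrite (_ : (fun t => _) = (fun t => complex.Re (v t) + complex.Re (w t)));
    [exact: rL2D|apply/funext => t; rewrite cReD].
by rewrite (_ : (fun t => _) = (fun t => complex.Im (v t) + complex.Im (w t)));
    [exact: rL2D|apply/funext => t; rewrite cImD].
Qed.

Lemma cL2Z c v : cL2 v -> cL2 (fun t => c * v t).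
Proof.
move=> [v1 v2]; split.
  rewrite (_ : (fun t => _) =
     (fun t => complex.Re c * complex.Re (v t) - complex.Im c * complex.Im (v t))).
    by apply: rL2B; apply: rL2Zl.
  by apply/funext => t; rewrite cReM.
rewrite (_ : (fun t => _) =
   (fun t => complex.Re c * complex.Im (v t) + complex.Im c * complex.Re (v t))).
  by apply: rL2D; apply: rL2Zl.
by apply/funext => t; rewrite cImM.
Qed.

Lemma cL2_slaplace v s : 0 < complex.Re s -> cL2 v -> cL1 time (fun t => cexp_ray (- s) t * v t).
Proof.
move=> s0 [v1 v2].
have := rL2_exp_L1 s0 v1 => /integrable_norm e1.
have := rL2_exp_L1 s0 v2 => /integrable_norm e2.
have m1 := @measurable_Re_cexp_ray R (- s) time.
have m2 := @measurable_Im_cexp_ray R (- s) time.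
have b1 t := Re_cexp_ray_le (- s) t; have b2 t := Im_cexp_ray_le (- s) t.
have Rs : complex.Re (- s) = - complex.Re s by case: (s).
have est (x y u z : R) t : `|x| <= expR (complex.Re (- s) * t) -> `|y| <= expR (complex.Re (- s) * t) ->
    `|x * u| + `|y * z| <= `|expR (- complex.Re s * t) * u| + `|expR (- complex.Re s * t) * z|.
  rewrite Rs => hx hy; rewrite !normrM [`|expR _|]ger0_norm ?expR_ge0//.
  by apply: lerD; apply: ler_wpM2r.
have [mv1 _] := v1; have [mv2 _] := v2.
have mRe : measurable_fun time (fun t => complex.Re (cexp_ray (- s) t * v t)).
  rewrite (_ : (fun t => _) = (fun t => complex.Re (cexp_ray (- s) t) * complex.Re (v t) -
    complex.Im (cexp_ray (- s) t) * complex.Im (v t))); last by apply/funext => t; rewrite cReM.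
  by apply: measurable_funB; apply: measurable_funM.
have mIm : measurable_fun time (fun t => complex.Im (cexp_ray (- s) t * v t)).
  rewrite (_ : (fun t => _) = (fun t => complex.Re (cexp_ray (- s) t) * complex.Im (v t) +
     complex.Im (cexp_ray (- s) t) * complex.Re (v t))); last by apply/funext => t; rewrite cImM.
  by apply: measurable_funD; apply: measurable_funM.
split; apply: le_L1 (L1D mt e1 e2) => // t _.
  by rewrite cReM; apply: le_trans (ler_normB _ _) _; exact: est.
by rewrite cImM addrC; apply: le_trans (ler_normD _ _) _; exact: est.
Qed.

Lemma slaplaceD v w s : 0 < complex.Re s -> cL2 v -> cL2 w ->
  slaplace (fun t => v t + w t) s = slaplace v s + slaplace w s.
Proof.
move=> s0 hv hw; rewrite /slaplace -cintD//; [|exact: cL2_slaplace|exact: cL2_slaplace].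
by apply: eq_cint => t _; rewrite mulrDr.
Qed.

Lemma slaplaceZ c v s : 0 < complex.Re s -> cL2 v -> slaplace (fun t => c * v t) s = c * slaplace v s.
Proof.
move=> s0 hv; rewrite /slaplace -cintZ//; last exact: cL2_slaplace.
by apply: eq_cint => t _; rewrite mulrCA.
Qed.

(** Splitting [exp (- s t)] as [exp (- s (t - u)) exp (- s u)] turns the weighted convolution into
    the convolution of the weighted, hence integrable, signal with the kernel of exponent [p - s].
    [cint_cconv] at [q = p - s] then gives the factor [(s - p)^-1]. *)
Lemma slaplace_lag p v : complex.Re p < 0 -> cL2 v ->
  exists2 w, cL2 w & forall s, 0 < complex.Re s -> slaplace w s = (s - p)^-1 * slaplace v s.
Proof.
move=> p0 hv; exists (cconv p v); first exact: (cL2_cconv p0 hv).1.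
move=> s s0.
have q0 : complex.Re (p - s) < 0 by move: p0 s0; case: (p) (s) => a b [c d] /=; lra.
rewrite -opprB -(cint_cconv q0 (cL2_slaplace s0 hv)).2; apply: eq_cint => t _.
rewrite /cconv -(cintZ (measurable_0t t) _ ((cL2_cconv p0 hv).2 t)).
apply: eq_cint => u _.
have -> : cexp_ray (- s) t = cexp_ray (- s) (t - u) * cexp_ray (- s) u.
  by rewrite -cexp_rayDr subrK.
by rewrite cexp_rayD; ring.
Qed.

End ScalarLaplace.

(* Writing [Q = Q' (X - p) + Q(p)] peels off one pole at a time. *)
Lemma rational_filter (R : realType) (ps : seq R[i]) (Q : {poly R[i]}) (v : R -> R[i]) :
  (forall p, p \in ps -> complex.Re p < 0) -> (size Q <= (size ps).+1)%N -> cL2 v ->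
  exists2 w, cL2 w & forall s, 0 < complex.Re s ->
    slaplace w s = Q.[s] / \prod_(p <- ps) (s - p) * slaplace v s.
Proof.
move=> + + hv; elim: ps Q => [|p ps IH] Q hps.
  move=> /size1_polyC ->; exists (fun t => Q`_0 * v t); first exact: cL2Z.
  by move=> s s0; rewrite slaplaceZ// hornerC big_nil divr1.
move=> sQ.
have hps' p' : p' \in ps -> complex.Re p' < 0 by move=> h; apply: hps; rewrite inE h orbT.
have p0 : complex.Re p < 0 by apply: hps; rewrite mem_head.
set d := 'X - p%:P.
have [|w1 hw1 E1] := IH (Q %/ d) hps'.
  by rewrite size_divp ?polyXsubC_eq0// size_XsubC /= leq_subLR add1n.
(* The remainder of the division is the constant [Q.[p]]; its share of the filter is the all-pole
   filter of [ps] followed by the lag at [p]. *)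
have [|w2 hw2 E2] := IH 1 hps'; first by rewrite size_poly1.
have [w3 hw3 E3] := slaplace_lag p0 hw2.
exists (fun t => w1 t + Q.[p] * w3 t); first by apply: cL2D => //; exact: cL2Z.
move=> s s0; rewrite slaplaceD ?slaplaceZ ?E3 ?E2 ?E1//; last exact: cL2Z.
rewrite [in RHS](divp_eq Q d) modp_XsubC hornerD hornerM hornerXsubC !hornerC big_cons.
have sp : s - p != 0.
  by apply/negP => /eqP/(congr1 (@complex.Re R)); move: p0 s0; case: (p) (s) => a b [c e] /=; lra.
have pp : \prod_(p <- ps) (s - p) != 0.
  rewrite prodf_seq_neq0; apply/allP => x /hps' x0 /=; apply/negP => /eqP/(congr1 (@complex.Re R)).
  by move: x0 s0; case: (x) (s) => a b [c e] /=; lra.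
by field; rewrite sp pp.
Qed.

Lemma conjcM (R : realType) (x y : R[i]) : conjc (x * y) = conjc x * conjc y.
Proof. exact: rmorphM. Qed.

Lemma cexp_conj (R : realType) (z : R[i]) : cexp (conjc z) = conjc (cexp z).
Proof. by case: z => a b; apply: complex_eq; rewrite /cexp /= ?cosN ?sinN ?mulrN. Qed.

Lemma slaplace_conj (R : realType) (v : R -> R[i]) s : 0 < complex.Re s -> cL2 v ->
  slaplace (fun t => conjc (v t)) s = conjc (slaplace v (conjc s)).
Proof.
move=> s0 hv; have s0' : 0 < complex.Re (conjc s) by case: (s) s0.
have [h1 h2] := cL2_slaplace s0' hv.
have E t : cexp_ray (- s) t * conjc (v t) = conjc (cexp_ray (- conjc s) t * v t).
  have -> : cexp_ray (- s) t = conjc (cexp_ray (- conjc s) t).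
    rewrite /cexp_ray -cexp_conj [in RHS]conjcM.
    have -> : conjc (- conjc s) = - s by case: (s) => a b; rewrite /= opprK.
    by have -> : conjc (rc t) = rc t by exact: conjc_real.
  by rewrite conjcM.
apply: complex_eq; rewrite /slaplace /cint.
  by apply: eq_Rintegral => t _; rewrite E; case: (_ * _).
transitivity (-1 * complex.Im (cint time (fun t => cexp_ray (- conjc s) t * v t))).
  rewrite -(RintegralZl _ (@measurable_time R) h2).
  by apply: eq_Rintegral => t _; rewrite E mulN1r; case: (_ * _).
by rewrite mulN1r.
Qed.

Lemma cpoly_horner_conj (R : realType) (p : {poly R}) s :
  conjc (cpoly p).[conjc s] = (cpoly p).[s].
Proof.
rewrite -horner_map /= conjcK -map_poly_comp; congr (_.[s]).
by apply: eq_map_poly => x /=; rewrite oppr0.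
Qed.

(* For real signals the output of the complex filter is replaced by its real part. *)
Lemma real_rational_filter (R : realType) (F : set R[i]) (P Q : {poly R}) (v : R -> R[i]) :
  F = @real_scalars R \/ F = @complex_scalars R ->
  hurwitz P -> (size Q <= size P)%N -> cL2 v -> (forall t, 0 <= t -> F (v t)) ->
  exists w, [/\ cL2 w, forall t, 0 <= t -> F (w t) & forall s, 0 < complex.Re s ->
    slaplace w s = (cpoly Q).[s] / (cpoly P).[s] * slaplace v s].
Proof.
move=> hF hP sQ hv Fv.
have P0 := hurwitz_neq0 hP.
have sP : size P = (size P).-1.+1 by rewrite prednK// size_poly_gt0.
have lP : P`_(size P).-1 != 0 by rewrite -/(lead_coef P) lead_coef_eq0.
have [|ps sz Hps] := @cpoly_factor R (size P).-1 P _ lP; first by rewrite -sP.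
have hps p : p \in ps -> complex.Re p < 0 by move=> pp; apply: hP; apply: (Hps p).2.
have [|w hw E] := rational_filter (Q := (rc P`_(size P).-1)^-1 *: cpoly Q) hps _ hv.
  by apply: leq_trans (size_scale_leq _ _) _; rewrite size_map_poly sz -sP.
have {}E s : 0 < complex.Re s -> slaplace w s = (cpoly Q).[s] / (cpoly P).[s] * slaplace v s.
  by move=> s0; rewrite E// hornerZ (Hps s).1 invfM mulrA mulrAC [_^-1 * _]mulrC mulrAC.
case: hF => FE; last by exists w; split=> // t _; rewrite FE.
rewrite FE in Fv *.
have [w1 w2] := hw.
have hc : cL2 (fun t => conjc (w t)).
  split; first by rewrite (_ : (fun t => _) = (fun t => complex.Re (w t)))//;
    apply/funext => t; case: (w t).
  rewrite (_ : (fun t => _) = (fun t => -1 * complex.Im (w t))); first exact: rL2Zl.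
  by apply/funext => t; rewrite mulN1r; case: (w t).
exists (fun t => 2^-1 * (w t + conjc (w t))); split.
- by apply: cL2Z; exact: cL2D.
- by move=> t _; rewrite mulrC -ReJ_add.
- move=> s s0; rewrite slaplaceZ//; last exact: cL2D.
  have s0' : 0 < complex.Re (conjc s) by case: (s) s0.
  (* With [P], [Q] and [v] real, the transform of the conjugate of [w] equals that of [w], so
     averaging the two leaves the transform unchanged. *)
  rewrite slaplaceD// slaplace_conj// !E// conjcM conjcM conjc_inv.
  rewrite !cpoly_horner_conj.
  have -> : conjc (slaplace v (conjc s)) = slaplace v s.
    rewrite -slaplace_conj//; apply: eq_cint => t; rewrite /= in_itv /= andbT => /Fv.
    by rewrite /real_scalars /=; case: (v t) => a b /= ->; rewrite oppr0.
  set z := _ * slaplace v s; have -> : z + z = 2 * z by ring.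
  by rewrite mulKf// pnatr_eq0.
Qed.

(** * Lerch's theorem *)

Lemma bernoulli_ge (R : realType) (y : R) N : 0 <= y <= 1 -> 1 - N%:R * y <= (1 - y) ^+ N.
Proof.
move=> /andP[y0 y1]; elim: N => [|N IH]; first by rewrite mul0r subr0 expr0.
have N0 : 0 <= N%:R :> R by [].
by rewrite exprS -natr1; move: IH; set p := (1 - y) ^+ N; nra.
Qed.

Lemma bernoulli_le (R : realType) (y : R) N : 0 <= y <= 1 -> (1 - y) ^+ N * (1 + N%:R * y) <= 1.
Proof.
move=> /andP[y0 y1]; elim: N => [|N IH]; first by rewrite mul0r addr0 expr0 mulr1.
apply: le_trans IH; rewrite exprSr -mulrA ler_wpM2l ?exprn_ge0 ?subr_ge0//.
have N0 : 0 <= N%:R :> R by [].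
by rewrite -natr1; nra.
Qed.

(* The Brosowski-Deutsch polynomials: an approximate step at [x = 1 / 2]. *)
Definition step_poly (R : realType) (x : R) (m : nat) : R := (1 - x ^+ m) ^+ (2 ^ m).

Lemma step_poly01 (R : realType) (x : R) m : 0 <= x <= 1 -> 0 <= step_poly x m <= 1.
Proof.
move=> /andP[x0 x1]; have y0 : 0 <= x ^+ m by rewrite exprn_ge0.
have y1 : x ^+ m <= 1 by rewrite exprn_ile1.
by rewrite /step_poly exprn_ge0 ?exprn_ile1 ?subr_ge0// lerBlDr lerDl.
Qed.

(** Bernoulli's inequality with exponent [2 ^ m] bounds the value below by [1 - (2 x) ^ m]. *)
Lemma step_poly_cvg1 (R : realType) (x : R) : 0 <= x -> 2 * x < 1 -> step_poly x m @[m --> \oo] --> (1 : R).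
Proof.
move=> x0 x1.
have h : 1 - (2 * x) ^+ m @[m --> \oo] --> (1 : R).
  rewrite -[X in _ --> X]subr0; apply: cvgB; first exact: cvg_cst.
  by apply: cvg_expr; rewrite ger0_norm// mulr_ge0.
apply: (@squeeze_cvgr _ _ _ _ _ (cst (1 : R)) _ _ _ h (cvg_cst _)); apply: nearW => m.
have x01 : 0 <= x <= 1 by rewrite x0 /=; lra.
have /andP[_ ->] := step_poly01 m x01; rewrite andbT.
have y01 : 0 <= x ^+ m <= 1 by case/andP: x01 => ? ?; rewrite exprn_ge0 ?exprn_ile1.
by have := bernoulli_ge (2 ^ m) y01; rewrite natrX -exprMn.
Qed.

(** The reciprocal form of Bernoulli's inequality bounds the value above by [(2 x) ^ (- m)]. *)
Lemma step_poly_cvg0 (R : realType) (x : R) : 0 <= x <= 1 -> 1 < 2 * x -> step_poly x m @[m --> \oo] --> (0 : R).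
Proof.
move=> x01 x1.
have h : (2 * x)^-1 ^+ m @[m --> \oo] --> (0 : R).
  apply: cvg_expr; rewrite ger0_norm ?invr_ge0; last lra.
  by rewrite invf_lt1//; lra.
apply: (@squeeze_cvgr _ _ _ _ (cst (0 : R)) _ _ _ _ (cvg_cst _) h); apply: nearW => m.
have /andP[h0 _] := step_poly01 m x01; rewrite h0 /=.
have y01 : 0 <= x ^+ m <= 1 by case/andP: x01 => ? ?; rewrite exprn_ge0 ?exprn_ile1.
have p0 : 0 < (2 * x) ^+ m by rewrite exprn_gt0//; lra.
rewrite exprVn -[leRHS]mul1r ler_pdivlMr//.
apply: le_trans (bernoulli_le (2 ^ m) y01); rewrite natrX -exprMn.
by rewrite ler_wpM2l// lerDr.
Qed.

Section Lerch.
Variables (R : realType) (g : R -> R).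
Hypothesis gL1 : mu.-integrable time (EFin \o g).
Hypothesis g0 : forall x, 0 <= x -> \int[mu]_(t in time) (expR (- x * t) * g t) = 0.

Let mt := @measurable_time R.

Let E01 (x t : R) : 0 <= x -> 0 <= t -> 0 <= expR (- x * t) <= 1.
Proof.
move=> x0 t0; rewrite expR_ge0 -[leRHS]expR0 ler_expR mulNr oppr_le0.
exact: mulr_ge0.
Qed.

Let powL1 (b x : R) N : 0 <= b -> 0 <= x ->
  mu.-integrable time (EFin \o (fun t => (1 - expR (- b * t)) ^+ N * expR (- x * t) * g t)).
Proof.
move=> b0 x0; apply: le_L1 (integrable_norm gL1) => //.
  apply: measurable_funM; last exact: L1_measurable gL1.
  apply: measurable_funM; last exact: measurable_expRM.
  apply: measurable_funX; apply: measurable_funB => //; exact: measurable_expRM.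
move=> t; rewrite /= in_itv /= andbT => t0.
have /andP[h1 h2] := E01 b0 t0; have /andP[h3 h4] := E01 x0 t0.
rewrite normrM ler_piMl// ger0_norm ?mulr_ge0 ?exprn_ge0 ?subr_ge0//.
by rewrite mulr_ile1 ?exprn_ge0 ?exprn_ile1 ?subr_ge0// lerBlDr lerDl.
Qed.

(** One more factor [1 - exp (- b t)] gives the difference of the integrals at [x] and [x + b], so
    induction on [N] for all [x] replaces the binomial expansion. *)
Let pow0 (b x : R) N : 0 <= b -> 0 <= x ->
  \int[mu]_(t in time) ((1 - expR (- b * t)) ^+ N * expR (- x * t) * g t) = 0.
Proof.
move=> b0; elim: N x => [|N IH] x x0.
  by under eq_Rintegral do rewrite expr0 mul1r; exact: g0.
have xb : 0 <= x + b by rewrite addr_ge0.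
transitivity (\int[mu]_(t in time) ((1 - expR (- b * t)) ^+ N * expR (- x * t) * g t) -
  \int[mu]_(t in time) ((1 - expR (- b * t)) ^+ N * expR (- (x + b) * t) * g t)).
  rewrite -RintegralB//; [|exact: powL1|exact: powL1].
  apply: eq_Rintegral => t _; rewrite exprSr.
  have -> : - (x + b) * t = - x * t + - b * t by ring.
  by rewrite expRD; ring.
by rewrite !IH// subr0.
Qed.

Let tail0 (T : R) : 0 < T -> \int[mu]_(t in time) ((if T < t then 1 else 0) * g t) = 0.
Proof.
(* The rate [l] is chosen so that [expR (- l * T) = 1 / 2]: the step polynomials in [expR (- l * t)]
   then converge to the indicator of [T < t]. *)
move=> T0; pose l := ln 2 / T.
have ln2 : 0 < ln 2 :> R by rewrite ln_gt0// ltr1n.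
have l0 : 0 < l by rewrite divr_gt0.
have eT : expR (- l * T) = 2^-1 by rewrite mulNr expRN /l divfK ?gt_eqF// lnK// posrE.
have mg := L1_measurable gL1.
have D := @dominated_convergence _ _ _ mu time mt
  (fun m t => (step_poly (expR (- l * t)) m * g t)%:E) (fun t => ((if T < t then 1 else 0) * g t)%:E)
  (fun t => `|g t|%:E).
have [] := D.
- move=> m; apply/measurable_EFinP; apply: measurable_funM => //.
  apply: measurable_funX; apply: measurable_funB => //; apply: measurable_funX.
  exact: measurable_expRM.
- apply/measurable_EFinP; apply: measurable_funM => //.
  apply: measurable_funTS; apply: measurable_fun_ifT => //.
  exact: measurable_fun_ltr.
(* At [t = T] the argument is exactly 1/2, where the limit of the step polynomials is not
   controlled; this single point is null. *)
- exists [set T]; split; [exact: measurable_set1|exact: lebesgue_measure_set1|].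
  move=> t /=; apply: contra_notP => tT; rewrite in_itv /= andbT => t0.
  have x01 := E01 (ltW l0) t0.
  apply: cvg_EFin; first exact: nearW.
  apply: cvgM; last exact: cvg_cst.
  have [Tt|tT'] := ltP T t.
    apply: step_poly_cvg1; first by case/andP: x01.
    have : expR (- l * t) < expR (- l * T) by rewrite ltr_expR !mulNr ltrN2 ltr_pM2l.
    by rewrite eT; lra.
  apply: step_poly_cvg0 => //.
  have : expR (- l * T) < expR (- l * t).
    by rewrite ltr_expR !mulNr ltrN2 ltr_pM2l// lt_neqAle tT' andbT; apply/eqP.
  by rewrite eT; lra.
- exact: integrable_norm.
- apply: aeW => t m; rewrite /= in_itv /= andbT => t0.
  have /andP[h0 h1] := step_poly01 m (E01 (ltW l0) t0).
  by rewrite lee_fin normrM ler_piMl// ger0_norm.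
move=> fi _.
rewrite [X in X x @[x --> _] --> _](_ : _ = cst 0%E); last first.
  apply/funext => m; have lm : 0 <= l * m%:R by rewrite mulr_ge0// ltW.
  have h := pow0 (2 ^ m) lm (lexx 0); have hi := powL1 (2 ^ m) lm (lexx 0).
  transitivity ((\int[mu]_(t in time)
    ((1 - expR (- (l * m%:R) * t)) ^+ (2 ^ m) * expR (- 0 * t) * g t))%:E); last by rewrite h.
  rewrite L1_fineK//; apply: eq_integral => t _.
  rewrite oppr0 mul0r expR0 mulr1 /step_poly -expRM_natl; congr ((_ * _)%:E).
  by congr ((1 - expR _) ^+ _); rewrite mulr_natl -mulr_natr; ring.
move=> /(cvg_unique _ (cvg_cst _)) h.
by rewrite /Rintegral -h.
Qed.

(* The primitive of [g] vanishes identically, so Lebesgue differentiation applies. *)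
Lemma lerch : {ae mu, forall t, 0 <= t -> g t = 0}.
Proof.
have G := (integrable_mkcond _ mt).1 gL1.
rewrite restrict_EFin in G.
have Gy y : mu.-integrable [set` Interval (BLeft 0) (BRight y)] (EFin \o (g \_ time)).
  exact: integrableS G.
have loc : locally_integrable [set: R] (g \_ time) by apply: integrable_locally.
(* For [y > 0] the integral over [[0, y]] is the full integral minus the tail beyond [y], and both
   vanish. *)
have F0 y : \int[mu]_(t in [set` Interval (BLeft 0) (BRight y)]) (g \_ time) t = 0.
  have [y0|y0|<-] := ltgtP 0 y.
  - have tl := tail0 y0; have g00 := g0 (lexx 0).
    have tli : mu.-integrable time (EFin \o (fun t => (if y < t then 1 else 0) * g t)).
      apply: le_L1 (integrable_norm gL1) => //.
        apply: measurable_funM; last exact: L1_measurable gL1.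
        apply: measurable_funTS; apply: measurable_fun_ifT => //; exact: measurable_fun_ltr.
      by move=> t _ /=; case: ifP; rewrite ?mul1r ?mul0r ?normr0.
    transitivity (\int[mu]_(t in time) (g t - (if y < t then 1 else 0) * g t)).
      rewrite Rintegral_mkcond [RHS]Rintegral_mkcond; apply: eq_Rintegral => t _.
      rewrite /patch !mem_setE !in_itv /= andbT.
      by case: (leP 0 t) => //= _; case: leP => _; rewrite ?mul0r ?subr0 ?mul1r ?subrr.
    rewrite RintegralB// tl subr0 -[RHS]g00; apply: eq_Rintegral => t _.
    by rewrite oppr0 mul0r expR0 mul1r.
  - by rewrite set_itv_ge ?Rintegral_set0// bnd_simp -ltNge.
  - by rewrite set_itv1 Rintegral_set1.
have [N [mN N0 sN]] := FTC1 Gy loc.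
have m0 : measurable ([set 0] : set (measurableTypeR R)) by exact: measurable_set1.
exists (N `|` [set 0]); split; first exact: measurableU.
  rewrite [LHS]null_set_setU//; exact: lebesgue_measure_set1.
move=> t /= /not_implyP[t0 gt]; have [tz|tz] := eqVneq t 0; [by right|left; apply: sN => /= h].
apply: gt; have tp : (0%:E < t%:E)%E by rewrite lte_fin lt_neqAle eq_sym tz.
have [_] := h tp; rewrite (_ : (fun y => _) = cst 0); last by apply/funext.
by rewrite derive1_cst patchE mem_setE in_itv /= andbT t0.
Qed.

End Lerch.

(** * The closed loop *)

Lemma cexp_ray_real (R : realType) (x t : R) : cexp_ray (- rc x) t = rc (expR (- x * t)).
Proof.
apply: complex_eq; rewrite ?Re_cexp_ray ?Im_cexp_ray /= oppr0 mul0r.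
  by rewrite cos0 mulr1.
by rewrite sin0 mulr0.
Qed.

(** Lerch's theorem is applied to the real and imaginary parts of [exp (- s0 t) z t], whose
    transforms vanish on the whole half-line [x >= 0]. The exponential factor is positive, so it can
    be cancelled pointwise. *)
Lemma slaplace_inj (R : realType) (z : R -> R[i]) (s0 : R) :
  cL1 time (fun t => cexp_ray (- rc s0) t * z t) ->
  (forall x, 0 <= x -> slaplace z (rc (x + s0)) = 0) ->
  {ae mu, forall t, 0 <= t -> complex.Re (z t) = 0} /\
  {ae mu, forall t, 0 <= t -> complex.Im (z t) = 0}.
Proof.
move=> [h1 h2] hz.
have E x t : expR (- (x + s0) * t) = expR (- x * t) * expR (- s0 * t).
  by rewrite -expRD; congr expR; ring.
have main (pr : R[i] -> R) : (forall a c, pr (rc a * c) = a * pr c) ->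
    mu.-integrable time (EFin \o (fun t => pr (cexp_ray (- rc s0) t * z t))) ->
    (forall x, 0 <= x -> \int[mu]_(t in time) pr (cexp_ray (- rc (x + s0)) t * z t) = 0) ->
    {ae mu, forall t, 0 <= t -> pr (z t) = 0}.
  move=> prM hL h0.
  have [|N [mN N0 sN]] := @lerch R (fun t => pr (cexp_ray (- rc s0) t * z t)) hL.
    move=> x x0; rewrite -[RHS](h0 x x0); apply: eq_Rintegral => t _.
    by rewrite !cexp_ray_real !prM E mulrA.
  exists N; split=> //; apply: subset_trans sN; apply: subsetC => t /= ht t0.
  have := ht t0; rewrite cexp_ray_real prM => /eqP; rewrite mulf_eq0 gt_eqF ?expR_gt0//=.
  by move/eqP.
split; [apply: (main (@complex.Re R)) => //|apply: (main (@complex.Im R)) => //].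
- exact: Re_rcM.
- by move=> x x0; have := congr1 (@complex.Re R) (hz x x0).
- exact: Im_rcM.
- by move=> x x0; have := congr1 (@complex.Im R) (hz x x0).
Qed.

Lemma rL2_ae (R : realType) (g h : R -> R) : measurable_fun time g -> rL2 h ->
  {ae mu, forall t, 0 <= t -> g t - h t = 0} -> rL2 g.
Proof.
move=> mg [mh ih] [N [mN N0 sN]]; split=> //.
apply: L1P => //; first by move=> t _; exact: sqr_ge0.
  exact: measurable_funX.
rewrite (ae_eq_integral _ _ _ _ _ (_ : ae_eq mu time _ (fun t => (h t ^+ 2)%:E)))//.
- exact: L1_lty.
- by apply/measurable_EFinP; exact: measurable_funX.
- by apply/measurable_EFinP; exact: measurable_funX.
- exists N; split=> //; apply: subset_trans sN; apply: subsetC => t /= ht.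
  by rewrite in_itv /= andbT => /ht /eqP; rewrite subr_eq0 => /eqP ->.
Qed.

(** * Vector signals treated componentwise *)

Section Signals.
Variables (R : realType) (n : nat).
Implicit Types (y u e : R -> 'cV[R[i]]_n) (F : set R[i]).

Definition vL2 y : Prop := forall k, cL2 (fun t => y t k 0).

Let Re_le (x : 'cV[R[i]]_n) k : complex.Re (x k 0) ^+ 2 <= vnorm x ^+ 2.
Proof.
rewrite vnorm_sqr (bigD1 k)//= -addrA lerDl addr_ge0 ?sqr_ge0// sumr_ge0// => j _.
by rewrite addr_ge0 ?sqr_ge0.
Qed.

Let Im_le (x : 'cV[R[i]]_n) k : complex.Im (x k 0) ^+ 2 <= vnorm x ^+ 2.
Proof.
rewrite vnorm_sqr (bigD1 k)//= addrAC lerDr addr_ge0 ?sqr_ge0// sumr_ge0// => j _.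
by rewrite addr_ge0 ?sqr_ge0.
Qed.

Let vnorm_ge0 (x : 'cV[R[i]]_n) : 0 <= vnorm x.
Proof. exact: sqrtr_ge0. Qed.

Lemma Re_vnorm (x : 'cV[R[i]]_n) k : `|complex.Re (x k 0)| <= vnorm x.
Proof. by rewrite -ler_sqr ?nnegrE// real_normK ?num_real// Re_le. Qed.

Lemma Im_vnorm (x : 'cV[R[i]]_n) k : `|complex.Im (x k 0)| <= vnorm x.
Proof. by rewrite -ler_sqr ?nnegrE// real_normK ?num_real// Im_le. Qed.

Lemma measurable_vnorm y :
  (forall k, measurable_fun time (fun t => complex.Re (y t k 0)) /\
             measurable_fun time (fun t => complex.Im (y t k 0))) ->
  measurable_fun time (fun t => vnorm (y t)).
Proof.
move=> my; rewrite (_ : (fun t => _) = (fun t => Num.sqrt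
    (\sum_(k < n) (complex.Re (y t k 0) ^+ 2 + complex.Im (y t k 0) ^+ 2)))).
  apply: measurableT_comp.
    by apply: continuous_measurable_fun; exact: sqrt_continuous.
  apply: measurable_sum => k; have [m1 m2] := my k.
  by apply: measurable_funD; exact: measurable_funX.
by apply/funext => t; rewrite /vnorm Re_cdotE.
Qed.

Lemma vL2_vnorm y : vL2 y -> rL2 (fun t => vnorm (y t)).
Proof.
move=> hy; split.
  by apply: measurable_vnorm => k; have [[m1 _] [m2 _]] := hy k.
rewrite (_ : (fun t => _) = (fun t =>
    \sum_(k < n) (complex.Re (y t k 0) ^+ 2 + complex.Im (y t k 0) ^+ 2))); last first.
  by apply/funext => t; rewrite vnorm_sqr.
have -> : EFin \o (fun t => \sum_(k < n) (complex.Re (y t k 0) ^+ 2 + complex.Im (y t k 0) ^+ 2)) =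
    (fun t => \sum_(k < n) (complex.Re (y t k 0) ^+ 2 + complex.Im (y t k 0) ^+ 2)%:E)%E.
  by apply/funext => t; rewrite /= sumEFin.
apply: integrable_sum => // k _; have [[_ h1] [_ h2]] := hy k.
exact: (L1D (@measurable_time R) h1 h2).
Qed.

Lemma L2P F y : L2 F y <-> is_signal F y /\ vL2 y.
Proof.
split=> [[sy iy]|[sy vy]]; split=> //.
  move=> k; have [_ [m1 m2]] := sy k.
  have h : mu.-integrable time (EFin \o (fun t => vnorm (y t) ^+ 2)).
    apply: L1P => //; first by move=> t _; exact: sqr_ge0.
    by apply: measurable_funX; apply: measurable_vnorm => j; have [_] := sy j.
  by split; [apply: le_rL2 h _ => // t _; exact: Re_le|apply: le_rL2 h _ => // t _; exact: Im_le].
by have [_ h] := vL2_vnorm vy; apply: L1_lty h.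
Qed.

Lemma laplaceE y s k : laplace y s k 0 = slaplace (fun t => y t k 0) s.
Proof. by rewrite mxE. Qed.

Lemma vL2_laplace_abs y sigma : 0 < sigma -> vL2 y -> laplace_abs sigma y.
Proof. by move=> s0 hy; apply: rL2_exp_L1 => //; exact: vL2_vnorm. Qed.

Lemma laplace_abs_cL1 F y sigma s k : is_signal F y -> laplace_abs sigma y ->
  sigma <= complex.Re s -> cL1 time (fun t => cexp_ray (- s) t * y t k 0).
Proof.
move=> sy hy ss; have [_ [m1 m2]] := sy k.
have e1 := @measurable_Re_cexp_ray R (- s) time.
have e2 := @measurable_Im_cexp_ray R (- s) time.
have h2 := L1Zl (@measurable_time R) 2 hy.
have ex t : 0 <= t -> expR (complex.Re (- s) * t) <= expR (- sigma * t).
  move=> t0; rewrite ler_expR; apply: ler_wpM2r => //.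
  by case: (s) ss => a b /=; rewrite lerN2.
have est (a b c d : R) t : 0 <= t -> `|a| <= expR (complex.Re (- s) * t) ->
    `|b| <= expR (complex.Re (- s) * t) -> `|c| <= vnorm (y t) -> `|d| <= vnorm (y t) ->
    `|a * c| + `|b * d| <= 2 * (expR (- sigma * t) * vnorm (y t)).
  move=> t0 ha hb hc hd; rewrite !normrM mulr_natl mulr2n.
  by apply: lerD; apply: ler_pM => //; apply: le_trans (ex t t0).
split; apply: (le_L1 _ _ _ h2) => //.
- rewrite (_ : (fun t => _) = (fun t => complex.Re (cexp_ray (- s) t) * complex.Re (y t k 0) -
    complex.Im (cexp_ray (- s) t) * complex.Im (y t k 0))); last by apply/funext => t; rewrite cReM.
  by apply: measurable_funB; apply: measurable_funM.
- move=> t; rewrite /= in_itv /= andbT => t0; rewrite cReM.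
  apply: le_trans (ler_normB _ _) _.
  by apply: est; rewrite ?Re_cexp_ray_le ?Im_cexp_ray_le ?Re_vnorm ?Im_vnorm.
- rewrite (_ : (fun t => _) = (fun t => complex.Re (cexp_ray (- s) t) * complex.Im (y t k 0) +
     complex.Im (cexp_ray (- s) t) * complex.Re (y t k 0))); last by apply/funext => t; rewrite cImM.
  by apply: measurable_funD; apply: measurable_funM.
- move=> t; rewrite /= in_itv /= andbT => t0; rewrite cImM.
  apply: le_trans (ler_normD _ _) _.
  by apply: est; rewrite ?Re_cexp_ray_le ?Im_cexp_ray_le ?Re_vnorm ?Im_vnorm.
Qed.

Lemma slaplaceB_of_cL1 (v w : R -> R[i]) s :
  cL1 time (fun t => cexp_ray (- s) t * v t) -> cL1 time (fun t => cexp_ray (- s) t * w t) ->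
  cL1 time (fun t => cexp_ray (- s) t * (v t - w t)) /\
  slaplace (fun t => v t - w t) s = slaplace v s - slaplace w s.
Proof.
move=> hv hw; have hw' := cL1Z (@measurable_time R) (-1) hw.
have E t : cexp_ray (- s) t * v t + -1 * (cexp_ray (- s) t * w t) =
  cexp_ray (- s) t * (v t - w t) by ring.
split; first by apply: cL1_ext (cL1D (@measurable_time R) hv hw').
rewrite /slaplace -[X in _ = _ + X]mulN1r -(cintZ (@measurable_time R) _ hw) -cintD//.
by apply: eq_cint => t _; rewrite E.
Qed.

End Signals.

Lemma cL2_0 (R : realType) : cL2 (fun _ : R => 0 : R[i]).
Proof.
have h : rL2 (fun _ : R => 0 : R).
  split; first exact: measurable_cst.
  rewrite (_ : EFin \o _ = cst 0%E); first exact: integrable0.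
  by apply/funext => t; rewrite /= expr0n.
by split.
Qed.

Lemma cL2_sum (R : realType) (I : Type) (r : seq I) (v : I -> R -> R[i]) :
  (forall i, cL2 (v i)) -> cL2 (fun t => \sum_(i <- r) v i t) /\
  forall s, 0 < complex.Re s ->
    slaplace (fun t => \sum_(i <- r) v i t) s = \sum_(i <- r) slaplace (v i) s.
Proof.
move=> hv; elim: r => [|i r [IH1 IH2]].
  have E : (fun t => \sum_(i <- [::]) v i t) = (fun t => 0 * 0).
    by apply/funext => t; rewrite big_nil mul0r.
  rewrite E; split=> [|s s0]; first by apply: cL2Z; exact: cL2_0.
  by rewrite slaplaceZ ?big_nil ?mul0r//; exact: cL2_0.
have -> : (fun t => \sum_(j <- i :: r) v j t) = (fun t => v i t + \sum_(j <- r) v j t).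
  by apply/funext => t; rewrite big_cons.
split=> [|s s0]; first exact: cL2D.
by rewrite big_cons slaplaceD// IH2.
Qed.

Lemma scalars_sum (R : realType) (F : set R[i]) (I : Type) (r : seq I) (f : I -> R[i]) :
  F = @real_scalars R \/ F = @complex_scalars R ->
  (forall i, F (f i)) -> F (\sum_(i <- r) f i).
Proof.
case=> -> //; rewrite /real_scalars /= => hf; elim: r => [|i r IH]; first by rewrite big_nil.
by rewrite big_cons cImD hf IH addr0.
Qed.

Section PolynomialMatrixEval.
Variables (R : realType) (n : nat) (s : R[i]).
Implicit Types A B : 'M[{poly R}]_n.

Lemma cmx_evalD A B : cmx_eval (A + B) s = cmx_eval A s + cmx_eval B s.
Proof. exact: (map_mxD (horner_eval s \o cpoly)). Qed.

Lemma cmx_evalM A B : cmx_eval (A *m B) s = cmx_eval A s *m cmx_eval B s.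
Proof. exact: (map_mxM (horner_eval s \o cpoly)). Qed.

Lemma cmx_eval_scalar (p : {poly R}) : cmx_eval (p%:M : 'M[{poly R}]_n) s = ((cpoly p).[s])%:M.
Proof. exact: (map_scalar_mx (horner_eval s \o cpoly)). Qed.

End PolynomialMatrixEval.

(** Clearing the denominator [c] turns the loop equation into a linear system for the output.
    Invertibility of [c + N] is a separate matter, needed only for uniqueness. *)
Lemma feedback_eq (K : fieldType) n (c : K) (N : 'M[K]_n) (U Y : 'cV[K]_n) : c != 0 ->
  Y = (c^-1 *: N) *m (U - Y) <-> (c%:M + N) *m Y = N *m U.
Proof.
move=> c0; rewrite -scalemxAl mulmxDl mul_scalar_mx mulmxBr; split=> [E|E].
  by rewrite {1}E scalerA mulfV// scale1r subrK.
by rewrite -E addrK scalerA mulVf// scale1r.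
Qed.

Section ClosedLoop.
Variables (R : realType) (n : nat) (H : 'M[{fraction {poly R}}]_n).
Hypothesis HRH : RHinf H.
Hypothesis Hfin : forall omega : R, 0 <= omega ->
  forall tau : R, 0 < tau -> tau <= 1 ->
    ~ dilate tau (SRG (tfm_eval H (Complex 0 omega))) (-1).
Hypothesis Hinf : forall tau : R, 0 < tau -> tau <= 1 ->
  ~ dilate tau (SRG (tfm_infty H)) (-1).
Variable F : set R[i].
Hypothesis hF : F = @real_scalars R \/ F = @complex_scalars R.

Let D := tfm_den H.
Let N := tfm_num H.
Let A : 'M[{poly R}]_n := D%:M + N.
Let P := \det A.

Let hP : hurwitz P. Proof. exact: hurwitz_return_difference. Qed.
Let hD : hurwitz D. Proof. exact: hurwitz_tfm_den. Qed.

(** Properness of the closed loop: the adjugate has degree at most [(n - 1) deg D], the factor [N]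
    adds at most [deg D], and [P] has degree at least [n * deg D]. *)
Let size_closed_loop k l : (size ((\adj A *m N) k l) <= size P)%N.
Proof.
apply: leq_trans (size_return_difference HRH Hinf); rewrite -/D.
have D0 : D != 0 by exact: hurwitz_neq0.
have sD : size D = (size D).-1.+1 by rewrite prednK// size_poly_gt0.
rewrite mxE; apply: leq_trans (size_sum _ _ _) _; apply/bigmax_leqP => j _.
apply: leq_trans (size_polyMleq _ _) _.
have sA i i' : (size (A i i') <= (size D).-1.+1)%N.
  rewrite -sD /A -[N]scale1r; apply: pencil_size; exact: size_tfm_num.
have h1 : (size (\adj A k j) <= (n.-1 * (size D).-1).+1)%N.
  by rewrite mxE; exact: cofactor_size.
have h2 : (size (N j l) <= (size D).-1.+1)%N by rewrite -sD; exact: size_tfm_num.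
have n0 : (0 < n)%N by exact: leq_ltn_trans (ltn_ord k).
have -> : (n * (size D).-1 = n.-1 * (size D).-1 + (size D).-1)%N.
  by rewrite -{1}(prednK n0) mulSn addnC.
rewrite -subn1 leq_subLR; apply: leq_trans (leq_add h1 h2) _.
by rewrite addSn addnS add1n.
Qed.

(** Cramer's rule realised in the time domain: component [k] of the output sums, over [l], the
    filter [(adj A N) k l / P] applied to component [l] of [u]. The identity [A adj A = P] then
    gives the equation for the transforms. *)
Lemma closed_loop_output u : L2 F u -> exists y, L2 F y /\
  forall s, 0 < complex.Re s -> cmx_eval A s *m laplace y s = cmx_eval N s *m laplace u s.
Proof.
move=> /L2P[su vu].
have /choice[w hw] (kl : 'I_n * 'I_n) : exists w, [/\ cL2 w, forall t, 0 <= t -> F (w t) &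
    forall s, 0 < complex.Re s -> slaplace w s =
      (cpoly ((\adj A *m N) kl.1 kl.2)).[s] / (cpoly P).[s] * slaplace (fun t => u t kl.2 0) s].
  apply: (real_rational_filter hF hP (size_closed_loop kl.1 kl.2) (vu kl.2)).
  by have [h _] := su kl.2.
pose y t : 'cV[R[i]]_n := \col_k \sum_l w (k, l) t.
have yE k : (fun t => y t k 0) = (fun t => \sum_l w (k, l) t).
  by apply/funext => t; rewrite mxE.
have w2 k l : cL2 (w (k, l)) by case: (hw (k, l)).
have hy k := cL2_sum (index_enum 'I_n) (w2 k).
have vy : vL2 y by move=> k; rewrite yE; case: (hy k).
exists y; split.
  apply/L2P; split=> // k; have [[m1 _] [m2 _]] := vy k; split=> // t t0.
  by rewrite mxE; apply: scalars_sum => // l; have [_ h _] := hw (k, l); exact: h.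
move=> s s0.
have P0 : (cpoly P).[s] != 0 by apply: hurwitz_horner => //; exact: ltW.
have -> : laplace y s = (cpoly P).[s]^-1 *: (cmx_eval (\adj A *m N) s *m laplace u s).
  apply/matrixP => k j; rewrite ord1 laplaceE yE (hy k).2// mxE mxE mulr_sumr.
  apply: eq_bigr => l _; have [_ _ ->//] := hw (k, l).
  by rewrite [cmx_eval _ _ _ _]mxE laplaceE mulrA [_ / (cpoly P).[s]]mulrC.
rewrite -scalemxAr mulmxA -cmx_evalM mulmxA mul_mx_adj cmx_evalM cmx_eval_scalar -/P.
by rewrite mul_scalar_mx -scalemxAl scalerA mulVf// scale1r.
Qed.

Lemma closed_loop_L2_stable : L2_stable F (closed_loop H).
Proof.
move=> u Lu; have [ys [Lys Eys]] := closed_loop_output Lu.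
have [su vu] := (L2P F u).1 Lu; have [sys vys] := (L2P F ys).1 Lys.
have D0 s : 0 < complex.Re s -> (cpoly D).[s] != 0.
  by move=> s0; apply: hurwitz_horner => //; exact: ltW.
have AE s : cmx_eval A s = ((cpoly D).[s])%:M + cmx_eval N s.
  by rewrite cmx_evalD cmx_eval_scalar.
split.
  exists ys; split=> //; exists (fun t => u t - ys t); split=> //.
  have cB s k : 0 < complex.Re s -> _ := fun s0 =>
    slaplaceB_of_cL1 (cL2_slaplace s0 (vu k)) (cL2_slaplace s0 (vys k)).
  have ve : vL2 (fun t => u t - ys t).
    move=> k; rewrite (_ : (fun t => _) = (fun t => u t k 0 + -1 * ys t k 0)).
      by apply: cL2D => //; exact: cL2Z.
    by apply/funext => t; rewrite !mxE mulN1r.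
  (* The abscissa can be any positive number, since L2 signals have absolutely convergent transforms
     on the open right half-plane. *)
  exists 1; split=> //; [exact: vL2_laplace_abs|exact: vL2_laplace_abs|].
  move=> s s1; have s0 : 0 < complex.Re s by exact: lt_trans s1.
  have -> : laplace (fun t => u t - ys t) s = laplace u s - laplace ys s.
    apply/matrixP => k j; rewrite ord1 [in RHS]mxE [X in _ = _ + X]mxE !laplaceE -(cB s k s0).2.
    by apply: eq_cint => t _; rewrite !mxE.
  rewrite tfm_evalE ?ltW//; apply/feedback_eq; first exact: D0.
  by rewrite -AE; exact: Eys.
move=> y sy [e [he [sigma [sig0 abe aby eqH]]]].
apply/L2P; split=> // k.
have sp : 0 < sigma + 1 by rewrite ltr_wpDl.
have cy s l : sigma < complex.Re s -> cL1 time (fun t => cexp_ray (- s) t * y t l 0).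
  by move=> h; apply: (laplace_abs_cL1 l sy aby); exact: ltW.
have Re_s (x : R) : 0 <= x -> sigma < complex.Re (rc (x + (sigma + 1))).
  by move=> x0 /=; lra.
(* Both [y] and [ys] solve [A(s) Y = N(s) U] to the right of [sigma], where [A(s)] is invertible
   because its determinant [P(s)] is nonzero. *)
have eqY s : sigma < complex.Re s -> laplace y s = laplace ys s.
  move=> ss; have s0 : 0 < complex.Re s by exact: le_lt_trans ss.
  have cB l := slaplaceB_of_cL1 (cL2_slaplace s0 (vu l)) (cy s l ss).
  have eE : laplace e s = laplace u s - laplace y s.
    apply/matrixP => l j; rewrite ord1 [in RHS]mxE [X in _ = _ + X]mxE !laplaceE -(cB l).2.
    by apply: eq_cint => t; rewrite /= in_itv /= andbT => /he ->; rewrite !mxE.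
  have Au : cmx_eval A s \in unitmx.
    rewrite unitmxE unitfE -det_cmx_eval; apply: hurwitz_horner => //; exact: ltW.
  apply: (can_inj (mulKmx Au)); rewrite Eys// AE; apply/feedback_eq; first exact: D0.
  by rewrite -eE -tfm_evalE ?ltW//; exact: eqH.
have Re0 : 0 < complex.Re (rc (sigma + 1)) by [].
have zB s (ss : sigma < complex.Re s) (s0 : 0 < complex.Re s) :=
  slaplaceB_of_cL1 (cy s k ss) (cL2_slaplace s0 (vys k)).
(* Transforms agree only for real part strictly above [sigma], so the half-line for Lerch's theorem
   starts at [sigma + 1]. *)
have ss1 : sigma < complex.Re (rc (sigma + 1)) by rewrite /= ltrDl.
have [|ae1 ae2] := slaplace_inj (zB _ ss1 Re0).1.
  move=> x x0; have ss := Re_s x x0.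
  have s0 : 0 < complex.Re (rc (x + (sigma + 1))) by exact: le_lt_trans ss.
  by rewrite (zB _ ss s0).2 -!laplaceE eqY// subrr.
have [_ [m1 m2]] := sy k; have [v1 v2] := vys k.
have ReB (a b : R[i]) : complex.Re (a - b) = complex.Re a - complex.Re b by case: a; case: b.
have ImB (a b : R[i]) : complex.Im (a - b) = complex.Im a - complex.Im b by case: a; case: b.
split.
  apply: rL2_ae m1 v1 _; have [Z [mZ Z0 sZ]] := ae1; exists Z; split=> //.
  by apply: subset_trans sZ; apply: subsetC => t /= h t0; rewrite -ReB; exact: h.
apply: rL2_ae m2 v2 _; have [Z [mZ Z0 sZ]] := ae2; exists Z; split=> //.
by apply: subset_trans sZ; apply: subsetC => t /= h t0; rewrite -ImB; exact: h.
Qed.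

End ClosedLoop.

Theorem corollary1 (R : realType) (n : nat) (H : 'M[{fraction {poly R}}]_n)
    (HRH : RHinf H)
    (Hfin : forall omega : R, 0 <= omega ->
       forall tau : R, 0 < tau -> tau <= 1 ->
         ~ dilate tau (SRG (tfm_eval H (Complex 0 omega))) (-1))
    (Hinf : forall tau : R, 0 < tau -> tau <= 1 ->
         ~ dilate tau (SRG (tfm_infty H)) (-1)) :
  L2_stable (@real_scalars R) (closed_loop H) /\
  L2_stable (@complex_scalars R) (closed_loop H).
Proof. by split; apply: closed_loop_L2_stable => //; [left|right]. Qed.
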